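(* Let $\mu$ be a nontrivial probability measure on $\partial\mathbb D$ with Verblunsky coefficients $(\alpha_n)$, and suppose $\lim_{n\to\infty}|\alpha_n|^{1/n}=r$ and $\frac1n\sum_{j=0}^{n-1}|\alpha_j|\to0$. Then the zero counting measures $\nu_n$ of $\Phi_n$ converge weakly to the uniform probability measure on the circle $\{|z|=r\}$.
   Context: $\partial\mathbb D$ is the unit circle; nontrivial means infinite support. $\Phi_n$ is the monic polynomial of degree $n$ with $\int\overline{z^j}\Phi_n\,d\mu=0$ for $0\le j<n$; $\alpha_n=-\overline{\Phi_{n+1}(0)}$. $\nu_n$ is the probability measure on $\overline{\mathbb D}$ giving weight $k/n$ to each zero of $\Phi_n$ of multiplicity $k$. *)

(* Defs.v *)
From HB Require Import structures.
From mathcomp Require Import all_boot all_order all_algebra.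
From mathcomp Require Import all_classical all_reals all_analysis.
From mathcomp Require Import complex.
Set Implicit Arguments. Unset Strict Implicit. Unset Printing Implicit Defensive.
Import Order.TTheory GRing.Theory Num.Theory.
Import numFieldNormedType.Exports.
Local Open Scope classical_set_scope.
Local Open Scope ring_scope.

(* A probability measure on the unit circle is represented by a probability
   measure [mu] on R (angles) concentrated on [0, 2pi[; the point of the
   circle with angle t is [expi t = cos t + i sin t]. *)
Definition expi {R : realType} (t : R) : R[i] := (cos t +i* sin t)%C.

Definition circle_prob {R : realType} (mu : probability R R) : Prop :=
  mu (~` `[0, 2 * pi[) = 0%E.

Definition nontrivial {R : realType} (mu : probability R R) : Prop :=
  forall s : seq R, mu [set x | x \in s] <> 1%E.

Definition orth_to {R : realType} (mu : probability R R) (p : {poly R[i]}) (j : nat) : Prop :=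
  (\int[mu]_t (complex.Re ((conjc (expi t ^+ j)) * p.[expi t]))%:E = 0)%E /\
  (\int[mu]_t (complex.Im ((conjc (expi t ^+ j)) * p.[expi t]))%:E = 0)%E.

Definition is_monic_OPUC {R : realType} (mu : probability R R) (Phi : nat -> {poly R[i]}) : Prop :=
  forall n, Phi n \is monic /\ size (Phi n) = n.+1 /\ forall j, (j < n)%N -> orth_to mu (Phi n) j.

Definition verblunsky {R : realType} (Phi : nat -> {poly R[i]}) (n : nat) : R[i] :=
  - conjc (Phi n.+1).[0].

Definition cabs {R : realType} (z : R[i]) : R :=
  Num.sqrt (complex.Re z ^+ 2 + complex.Im z ^+ 2).

(* Main.v *)
(** The zeros z_1, ..., z_n of Phi_n lie in the closed disc, and the Szego
    recursion for Phi_n and its reversal Phi_n^*(z) = prod_j (1 - conj z_j z)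
    follows from orthogonality.

    Arguments.  The recursion gives, as power series,
    Phi_{n+1}^* = Phi_n^* (1 - alpha_n z b_n) with b_n = Phi_n / Phi_n^*.  The m-th
    coefficient of b_n is bounded uniformly in n, so each step changes the m-th
    coefficient of the logarithmic derivative of Phi_n^*, that is, up to sign and
    conjugation, the power sum of order m+1 of the zeros, by O(|alpha_n|).  Since
    the |alpha_j| average to 0, every power sum of order at least 1 is o(n).

    Moduli.  For r < rho < 1 the recursion on |z| = rho bounds rho^{-n} |Phi_n| by
    2 prod_{j<n} (1 + rho^{-j-1} |alpha_j|) = e^{o(n)}, so by Jensen
    sum_j log^+ (|z_j| / rho) = o(n) and only o(n) zeros have modulus above rho.
    As prod_j |z_j| = |alpha_{n-1}|, about r^n, only o(n) zeros can then have
    modulus well below r.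

    The power sums of the directions z_j / |z_j| are therefore o(n) as well, and
    Fejer's kernel turns this into equidistribution, in the manner of Weyl.
    Averages over roots of unity replace integrals over the circle throughout;
    only the last step passes from a Riemann sum to the integral. *)

Require Import Defs.
From HB Require Import structures.
From mathcomp Require Import all_boot all_order all_algebra.
From mathcomp Require Import all_classical all_reals all_analysis.
From mathcomp Require Import complex measurable_realfun.
From mathcomp Require Import ring lra.
Import Order.TTheory GRing.Theory Num.Theory.
Import numFieldNormedType.Exports.
Local Open Scope classical_set_scope.
Local Open Scope ring_scope.

(** * Complex modulus and the inner product of polynomials *)

Section ComplexModulus.
Context {R : realType}.
Implicit Types z w : R[i].

Lemma cabsE z : (cabs z)%:C%C = `|z|.
Proof. by rewrite normc_def. Qed.

Lemma cabs_ge0 z : 0 <= cabs z.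
Proof. exact: sqrtr_ge0. Qed.

Lemma cabsM z w : cabs (z * w) = cabs z * cabs w.
Proof. by apply: complexI; rewrite rmorphM /= !cabsE normrM. Qed.

Lemma cabs1 : cabs (1 : R[i]) = 1.
Proof. by apply: complexI; rewrite cabsE normr1. Qed.

Lemma cabs_eq0 z : (cabs z == 0) = (z == 0).
Proof. by rewrite -(inj_eq (@complexI R)) cabsE normr_eq0. Qed.

Lemma cabs0 : cabs (0 : R[i]) = 0.
Proof. by apply/eqP; rewrite cabs_eq0. Qed.

Lemma cabs_real (x : R) : cabs x%:C%C = `|x|.
Proof. by rewrite /cabs /= expr0n /= addr0 sqrtr_sqr. Qed.

Lemma cabsN z : cabs (- z) = cabs z.
Proof. by apply: complexI; rewrite !cabsE normrN. Qed.

Lemma cabsJ z : cabs (conjc z) = cabs z.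
Proof. by apply: complexI; rewrite !cabsE normcJ. Qed.

Lemma cabsX z n : cabs (z ^+ n) = cabs z ^+ n.
Proof. by elim: n => [|n IHn]; rewrite ?cabs1 // !exprS cabsM IHn. Qed.

Lemma cabs_prod (I : Type) (s : seq I) (F : I -> R[i]) :
  cabs (\prod_(i <- s) F i) = \prod_(i <- s) cabs (F i).
Proof. exact: (big_morph cabs cabsM cabs1). Qed.

Lemma ler_cabsD z w : cabs (z + w) <= cabs z + cabs w.
Proof. by rewrite -lecR rmorphD /= !cabsE ler_normD. Qed.

Lemma ler_cabsB z w : cabs (z - w) <= cabs z + cabs w.
Proof. by rewrite -(cabsN w) ler_cabsD. Qed.

Lemma ler_cabs_sum (I : Type) (s : seq I) (P : pred I) (F : I -> R[i]) :
  cabs (\sum_(i <- s | P i) F i) <= \sum_(i <- s | P i) cabs (F i).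
Proof.
elim/big_rec2: _ => [|i y x _ IH]; first by rewrite cabs0.
by apply: le_trans (ler_cabsD _ _) _; rewrite lerD2l.
Qed.

Lemma ler_Re_cabs z : `|complex.Re z| <= cabs z.
Proof. by rewrite -lecR cabsE normc_ge_Re. Qed.

Lemma ler_Im_cabs z : `|complex.Im z| <= cabs z.
Proof.
rewrite -sqrtr_sqr /cabs; apply: ler_wsqrtr.
by rewrite lerDr sqr_ge0.
Qed.

Lemma mulcJ z : z * conjc z = ((cabs z) ^+ 2)%:C%C.
Proof. by rewrite -sqr_normc rmorphXn /= cabsE. Qed.

Lemma cabs_expi (t : R) : cabs (expi t) = 1.
Proof. by rewrite /cabs /expi /= cos2Dsin2 sqrtr1. Qed.

Lemma expiD (s t : R) : expi (s + t) = expi s * expi t.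
Proof.
by rewrite /expi cosD sinD; congr (Complex _ _); rewrite addrC.
Qed.

Lemma expi_natr (t : R) n : expi (n%:R * t) = expi t ^+ n.
Proof.
elim: n => [|n IHn]; first by rewrite mul0r /expi cos0 sin0.
by rewrite exprS -IHn -expiD; congr expi; rewrite mulrSr; ring.
Qed.

Lemma conjcD z w : conjc (z + w) = conjc z + conjc w.
Proof. exact: rmorphD. Qed.

Lemma conjcM z w : conjc (z * w) = conjc z * conjc w.
Proof. exact: rmorphM. Qed.

Lemma cReD z w : complex.Re (z + w) = complex.Re z + complex.Re w.
Proof. by case: z w => [? ?] [? ?]. Qed.

Lemma cImD z w : complex.Im (z + w) = complex.Im z + complex.Im w.
Proof. by case: z w => [? ?] [? ?]. Qed.

Lemma cReM z w : complex.Re (z * w) =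
  complex.Re z * complex.Re w - complex.Im z * complex.Im w.
Proof. by case: z w => [? ?] [? ?]. Qed.

Lemma cImM z w : complex.Im (z * w) =
  complex.Re z * complex.Im w + complex.Im z * complex.Re w.
Proof. by case: z w => [? ?] [? ?]. Qed.

Lemma cRe_sum (I : Type) (s : seq I) (P : pred I) (F : I -> R[i]) :
  complex.Re (\sum_(i <- s | P i) F i) = \sum_(i <- s | P i) complex.Re (F i).
Proof. exact: (big_morph (@complex.Re R) cReD erefl). Qed.

End ComplexModulus.

Section InnerProduct.
Context {R : realType} (mu : probability R R).
Implicit Types (F G : R -> R[i]) (p q : {poly R[i]}).

Definition cint F : R[i] :=
  Complex (Rintegral mu setT (fun t => complex.Re (F t)))
          (Rintegral mu setT (fun t => complex.Im (F t))).

(** A class stable under sums, products and conjugation that is integrable against [mu], so [cint]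
    is linear on all trigonometric polynomials. *)
Definition bounded_continuous F :=
  [/\ continuous (fun t => complex.Re (F t)),
      continuous (fun t => complex.Im (F t)) &
      exists M : R, forall t, cabs (F t) <= M].

Lemma bcont_cst c : bounded_continuous (fun=> c).
Proof. by split; [exact: cst_continuous..|exists (cabs c)]. Qed.

Lemma bcontD F G : bounded_continuous F -> bounded_continuous G ->
  bounded_continuous (fun t => F t + G t).
Proof.
move=> [F1 F2 [A FA]] [G1 G2 [B GB]]; split.
- under eq_fun do rewrite cReD.
  by move=> t; exact: cvgD (F1 t) (G1 t).
- under eq_fun do rewrite cImD.
  by move=> t; exact: cvgD (F2 t) (G2 t).
- by exists (A + B) => t; apply: le_trans (ler_cabsD _ _) _; exact: lerD.
Qed.

Lemma bcontM F G : bounded_continuous F -> bounded_continuous G ->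
  bounded_continuous (fun t => F t * G t).
Proof.
move=> [F1 F2 [A FA]] [G1 G2 [B GB]]; split.
- under eq_fun do rewrite cReM.
  by move=> t; exact: cvgB (cvgM (F1 t) (G1 t)) (cvgM (F2 t) (G2 t)).
- under eq_fun do rewrite cImM.
  by move=> t; exact: cvgD (cvgM (F1 t) (G2 t)) (cvgM (F2 t) (G1 t)).
- by exists (A * B) => t; rewrite cabsM ler_pM ?cabs_ge0.
Qed.

Lemma bcontJ F : bounded_continuous F ->
  bounded_continuous (fun t => conjc (F t)).
Proof.
move=> [F1 F2 [A FA]]; split.
- rewrite (_ : (fun t => _) = fun t => complex.Re (F t)) //.
  by apply/funext => t; case: (F t).
- rewrite (_ : (fun t => _) = fun t => - complex.Im (F t)).
    by move=> t; exact: cvgN (F2 t).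
  by apply/funext => t; case: (F t).
- by exists A => t; rewrite cabsJ.
Qed.

Lemma bcont_expi : bounded_continuous expi.
Proof.
by split; [exact: continuous_cos|exact: continuous_sin|exists 1 => t; rewrite cabs_expi].
Qed.

Lemma bcont_horner p : bounded_continuous (fun t => p.[expi t]).
Proof.
elim/poly_ind: p => [|p c IHp].
  by under eq_fun do rewrite horner0; exact: bcont_cst.
under eq_fun do rewrite hornerMXaddC.
by apply: bcontD (bcont_cst c); apply: bcontM IHp bcont_expi.
Qed.

Let bcont_integrable (f : R -> R) M : continuous f -> (forall t, `|f t| <= M) ->
  mu.-integrable setT (EFin \o f).
Proof.
move=> cf fM; apply: measurable_bounded_integrable => //.
- exact: le_lt_trans (probability_le1 mu measurableT) (ltry _).
- exact: continuous_measurable_fun.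
- exists M; split; rewrite ?num_real // => x Mx y _ /=.
  by rewrite (le_trans (fM _)) // ltW.
Qed.

Lemma integrable_Re F : bounded_continuous F ->
  mu.-integrable setT (EFin \o (fun t => complex.Re (F t))).
Proof.
move=> [F1 _ [M FM]]; apply: (bcont_integrable _ M) => // t.
exact: le_trans (ler_Re_cabs _) (FM _).
Qed.

Lemma integrable_Im F : bounded_continuous F ->
  mu.-integrable setT (EFin \o (fun t => complex.Im (F t))).
Proof.
move=> [_ F1 [M FM]]; apply: (bcont_integrable _ M) => // t.
exact: le_trans (ler_Im_cabs _) (FM _).
Qed.

Lemma cintD F G : bounded_continuous F -> bounded_continuous G ->
  cint (fun t => F t + G t) = cint F + cint G.
Proof.
move=> bF bG; rewrite /cint; congr (Complex _ _).
  under eq_Rintegral do rewrite cReD.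
  by rewrite RintegralD //; exact: integrable_Re.
under eq_Rintegral do rewrite cImD.
by rewrite RintegralD //; exact: integrable_Im.
Qed.

Lemma cintZ c F : bounded_continuous F -> cint (fun t => c * F t) = c * cint F.
Proof.
move=> bF; have iR := integrable_Re _ bF; have iI := integrable_Im _ bF.
have iZ k f : mu.-integrable setT (EFin \o f) ->
    mu.-integrable setT (EFin \o (fun t : R => k * f t)).
  move=> fi; have := integrableZl measurableT k fi.
  by congr (mu.-integrable _ _); apply/funext.
case: c => a b; rewrite /cint; apply/eqP; rewrite eq_complex /=; apply/andP; split.
  under eq_Rintegral do rewrite cReM /=.
  by rewrite RintegralB // ?RintegralZl //; exact: iZ.
under eq_Rintegral do rewrite cImM /=.
by rewrite RintegralD // ?RintegralZl //; exact: iZ.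
Qed.

Lemma cintJ F : bounded_continuous F -> cint (fun t => conjc (F t)) = conjc (cint F).
Proof.
move=> bF; rewrite /cint /=; congr (Complex _ _).
  by apply: eq_Rintegral => t _; case: (F t).
rewrite -mulN1r -RintegralZl //; last exact: integrable_Im.
by apply: eq_Rintegral => t _; rewrite mulN1r; case: (F t).
Qed.

(** Conjugation falls on the first argument, so that [orth_to mu p j] says [ip 'X^j p = 0]. *)
Definition ip p q := cint (fun t => conjc p.[expi t] * q.[expi t]).

Lemma bcont_ip p q : bounded_continuous (fun t => conjc p.[expi t] * q.[expi t]).
Proof. by apply: bcontM (bcont_horner q); apply/bcontJ/bcont_horner. Qed.

Lemma ipDr p q1 q2 : ip p (q1 + q2) = ip p q1 + ip p q2.
Proof.
rewrite /ip -cintD; [|exact: bcont_ip..]; congr cint.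
by apply/funext => t; rewrite hornerD mulrDr.
Qed.

Lemma ipZr p c q : ip p (c *: q) = c * ip p q.
Proof.
rewrite /ip -cintZ; [|exact: bcont_ip]; congr cint.
by apply/funext => t; rewrite hornerZ mulrCA.
Qed.

Lemma ipC p q : ip p q = conjc (ip q p).
Proof.
rewrite /ip -cintJ; [|exact: bcont_ip]; congr cint.
by apply/funext => t; rewrite rmorphM /= conjcK mulrC.
Qed.

Lemma ipNr p q : ip p (- q) = - ip p q.
Proof. by rewrite -scaleN1r ipZr mulN1r. Qed.

Lemma ipBr p q1 q2 : ip p (q1 - q2) = ip p q1 - ip p q2.
Proof. by rewrite ipDr ipNr. Qed.

Lemma ip_sumr (I : Type) (s : seq I) p (F : I -> {poly R[i]}) :
  ip p (\sum_(i <- s) F i) = \sum_(i <- s) ip p (F i).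
Proof.
apply: (big_morph (ip p) (ipDr p)).
by rewrite -(scale0r 0) ipZr mul0r.
Qed.

Lemma ipDl p q1 q2 : ip (q1 + q2) p = ip q1 p + ip q2 p.
Proof. by rewrite ipC ipDr conjcD -!ipC. Qed.

Lemma ipZl p c q : ip (c *: q) p = conjc c * ip q p.
Proof. by rewrite ipC ipZr conjcM -ipC. Qed.

Lemma mulJ_unit (e : R[i]) : cabs e = 1 -> conjc e * e = 1.
Proof. by move=> e1; rewrite mulrC mulcJ e1 expr1n. Qed.

(** Multiplication by ['X] is isometric because the points of the circle have modulus 1. *)
Lemma ip_mulX p q : ip ('X * p) ('X * q) = ip p q.
Proof.
congr cint; apply/funext => t; rewrite !hornerM hornerX conjcM.
by rewrite mulrACA mulJ_unit ?cabs_expi // mul1r.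
Qed.

Lemma ip_diag p : ip p p = (complex.Re (ip p p))%:C%C.
Proof.
have /eqP := ipC p p; case: (ip p p) => a b; rewrite eq_complex /= => /andP[_ /eqP b0].
by congr (Complex _ _); lra.
Qed.

Lemma Re_ip p : complex.Re (ip p p) = Rintegral mu setT (fun t => cabs p.[expi t] ^+ 2).
Proof. by apply: eq_Rintegral => t _; rewrite mulrC mulcJ. Qed.

Lemma Re_ip_ge0 p : 0 <= complex.Re (ip p p).
Proof. by rewrite Re_ip; apply: Rintegral_ge0 => t _; rewrite sqr_ge0. Qed.

End InnerProduct.

(** * Orthogonality: zeros in the disc and the Szego recursion *)

Section Positivity.
Context {R : realType}.

(** If s < t, then v = (t - s) / 2 lies strictly between 0 and pi, so cos (t - s) = 1 - 2 sin^2 v <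
    1, while equal points force this cosine to be 1. *)
Lemma expi_inj (s t : R) : 0 <= s < 2 * pi -> 0 <= t < 2 * pi ->
  expi s = expi t -> s = t.
Proof.
wlog le_st : s t / s <= t => [W hs ht e|].
  case: (leP s t) => [|/ltW] le_st; first exact: W le_st hs ht e.
  by apply/esym; exact: W le_st ht hs (esym e).
move=> /andP[s0 s2] /andP[t0 t2] [ec es].
apply/eqP; rewrite eq_le le_st /= leNgt; apply/negP => lt_st.
pose v := (t - s) / 2.
have sv : 0 < sin v.
  by apply: sin_gt0_pi; rewrite ?divr_gt0 ?subr_gt0 // /v; lra.
have : cos (t - s) = 1 by rewrite cosB ec es -!expr2 cos2Dsin2.
rewrite (_ : t - s = v *+ 2); last by rewrite /v -mulr_natr; lra.
rewrite cos_mulr2n => c1.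
have := cos2Dsin2 v; have : 0 < sin v ^+ 2 by rewrite exprn_gt0.
by move: c1; rewrite -mulr_natr; lra.
Qed.

Variable mu : probability R R.
Hypotheses (muC : circle_prob mu) (muI : nontrivial mu).

(* A nonzero p has finitely many zeros on the circle; if |p|^2 integrated to 0, mu
   would be carried by the corresponding angles in [0, 2 pi[. *)
Lemma ip_definite (p : {poly R[i]}) : complex.Re (ip mu p p) = 0 -> p = 0.
Proof.
move=> p0; apply/eqP; apply: contraT => pN0.
have [rs def_p] := closed_field_poly_normal p.
pose ang z := xget 0 [set t : R | 0 <= t < 2 * pi /\ expi t = z].
pose s := [seq ang z | z <- rs].
have sP t : 0 <= t < 2 * pi -> p.[expi t] = 0 -> t \in s.
  move=> ht pt; have rt : expi t \in rs.
    move/eqP: pt; rewrite def_p hornerZ mulf_eq0 lead_coef_eq0 (negPf pN0) /=.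
    by rewrite -/(root _ _) root_prod_XsubC.
  suff <- : ang (expi t) = t by exact: map_f.
  rewrite /ang; case: xgetP => [t' -> [ht' e]|/(_ t) []//].
  exact: expi_inj ht' ht e.
have bp := bcont_ip p p.
pose g (t : R) := complex.Re (conjc p.[expi t] * p.[expi t]).
have gE t : g t = cabs p.[expi t] ^+ 2 by rewrite /g mulrC mulcJ.
have mf : measurable_fun setT (EFin \o g).
  exact/measurable_int/(integrable_Re mu _ bp).
have ae0 : {ae mu, forall t, p.[expi t] = 0}.
  have : (\int[mu]_(t in setT) `|(EFin \o g) t| = 0)%E.
    have Ef : (fun t => `|(EFin \o g) t|%E) = (fun t => (g t)%:E).
      by apply/funext => t; rewrite /= ger0_norm // gE sqr_ge0.
    rewrite Ef -[LHS]fineK; first by move: p0; rewrite /ip /cint /= /Rintegral => ->.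
    by apply: integrable_fin_num => //; exact: integrable_Re bp.
  move/(ae_eq_integral_abs _ measurableT mf); apply: filterS => t /(_ I) [].
  by rewrite gE => /eqP; rewrite sqrf_eq0 cabs_eq0 => /eqP.
exfalso; apply: (muI s).
have ms : measurable [set x | x \in s].
  apply: countable_measurable => [t|]; first exact: measurable_set1.
  exact: finite_set_countable (finite_seq s).
rewrite -(setCK [set x | x \in s]) probability_setC; last exact: measurableC.
suff -> : mu (~` [set x | x \in s]) = 0%E by rewrite sube0.
have [N [mN N0 NP]] := ae0.
have mI : measurable (~` `[0, 2 * pi[ : set R) by apply: measurableC.
apply: (@subset_measure0 _ _ _ mu _ (~` `[0, 2 * pi[ `|` N)).
- exact: measurableC.
- exact: measurableU.
- move=> t /= nst; have [ht|ht] := pselect (`[0, 2 * pi[%classic t); [right|by left].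
  by apply: NP => /= pt; apply: nst; apply: sP.
- exact: etrans (measureU0 mI mN N0) muC.
Qed.

(** Lets polynomial identities be checked on the circle only, where conjugation is inversion. *)
Lemma poly_eq0_circle (p : {poly R[i]}) : (forall t, p.[expi t] = 0) -> p = 0.
Proof.
move=> p0; apply: ip_definite; rewrite Re_ip.
under eq_Rintegral do rewrite p0 cabs0 expr0n /=.
by rewrite Rintegral_cst // mul0r.
Qed.

End Positivity.

Section Reversal.
Context {R : realType}.
Implicit Types (s : seq R[i]).

Definition star_prod s : {poly R[i]} := \prod_(z <- s) (1 - conjc z *: 'X).

Lemma star_prod0 s : (star_prod s).[0] = 1.
Proof.
rewrite horner_prod big1 // => z _.
by rewrite hornerD hornerN hornerZ hornerX hornerC mulr0 subr0.
Qed.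

(** Factor by factor: 1 - conj z e = e conj (e - z) when e conj e = 1. *)
Lemma star_prodE s (e : R[i]) : cabs e = 1 ->
  (star_prod s).[e] = e ^+ size s * conjc (\prod_(z <- s) ('X - z%:P)).[e].
Proof.
move=> e1; elim: s => [|z s IHs].
  by rewrite /star_prod !big_nil hornerC conjc1 mulr1.
rewrite /star_prod !big_cons !hornerM -/(star_prod s) IHs conjcM exprS !mulrA.
congr (_ * _); rewrite mulrAC; congr (_ * _).
rewrite hornerXsubC rmorphB /= mulrBr [e * conjc e]mulrC mulJ_unit //.
by rewrite hornerD hornerN hornerZ hornerX hornerC mulrC.
Qed.

Lemma size_star_prod s : (size (star_prod s) <= (size s).+1)%N.
Proof.
elim: s => [|z s IHs]; first by rewrite /star_prod big_nil size_poly1.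
rewrite /star_prod big_cons -/(star_prod s).
apply: leq_trans (size_polyMleq _ _) _.
have : (size (1 - conjc z *: 'X : {poly R[i]})%R <= 2)%N.
  apply: leq_trans (size_polyD _ _) _; rewrite geq_max size_poly1 size_polyN.
  by rewrite (leq_trans (size_scale_leq _ _)) // size_polyX.
by move=> s2; rewrite -subn1 leq_subLR; exact: leq_add s2 IHs.
Qed.

End Reversal.


Section OPUC.
Context {R : realType} (mu : probability R R) (Phi : nat -> {poly R[i]}).
Variable zeros : nat -> seq R[i].
Hypotheses (muC : circle_prob mu) (muI : nontrivial mu).
Hypothesis PhiP : is_monic_OPUC mu Phi.
Hypothesis zerosP : forall n, Phi n = \prod_(z <- zeros n) ('X - z%:P).

Lemma size_zeros n : size (zeros n) = n.
Proof.
have [_ [sPhi _]] := PhiP n; apply: succn_inj.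
by rewrite -sPhi zerosP size_prod_XsubC.
Qed.

Lemma ip_Xn_OPUC n j : (j < n)%N -> ip mu 'X^j (Phi n) = 0.
Proof.
have [_ [_ h]] := PhiP n => /h [hR hI]; rewrite /ip.
have E F : F =1 (fun t => conjc (expi t ^+ j) * (Phi n).[expi t]) ->
   cint mu F = 0.
  move=> /funext ->; rewrite /cint /Rintegral.
  by congr (Complex _ _); [rewrite hR|rewrite hI].
by apply: E => t; rewrite hornerXn.
Qed.

Lemma ip_OPUC n (q : {poly R[i]}) : (size q <= n)%N -> ip mu q (Phi n) = 0.
Proof.
move=> sq; rewrite -[q]coefK poly_def ipC ip_sumr big1 ?conjc0 // => i _.
rewrite ipZr ipC ip_Xn_OPUC ?conjc0 ?mulr0 //.
exact: leq_trans (ltn_ord i) sq.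
Qed.

(* Pythagoras: with Phi_n = (X - z) q and Phi_n orthogonal to q,
   |q|^2 = |X q|^2 = |Phi_n + z q|^2 = |Phi_n|^2 + |z|^2 |q|^2. *)
Lemma zeros_le1 n z : z \in zeros n -> cabs z <= 1.
Proof.
move=> zn; have [_ [sPhi _]] := PhiP n.
have [q Phiq] : exists q, Phi n = q * ('X - z%:P).
  by apply/factor_theorem; rewrite zerosP root_prod_XsubC.
have q0 : q != 0.
  by apply: contra_eq_neq sPhi => q0; rewrite Phiq q0 mul0r size_poly0.
have sq : (size q <= n)%N.
  by move: sPhi; rewrite Phiq size_Mmonic ?monicXsubC // size_XsubC addn2 /= => -[->].
have E : 'X * q = Phi n + z *: q by rewrite Phiq -mul_polyC; ring.
have := ip_mulX mu q q.
rewrite E ipDl !ipDr ipZl !ipZr ipZl [ip mu (Phi n) q]ipC !(ip_OPUC _ q) //.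
rewrite conjc0 !mulr0 addr0 add0r mulrA mulcJ ip_diag (ip_diag _ q).
have q_gt0 : 0 < complex.Re (ip mu q q).
  by rewrite lt_def Re_ip_ge0 andbT; apply: contraNneq q0 => /ip_definite ->.
have := Re_ip_ge0 mu (Phi n); move: q_gt0.
move: (complex.Re (ip mu (Phi n) (Phi n))) (complex.Re (ip mu q q)) => a b b0 a0.
move=> /(congr1 (@complex.Re R)) /=; rewrite mul0r subr0 => e.
rewrite -(@expr_le1 _ 2) ?cabs_ge0 // -subr_ge0 -(pmulr_lge0 _ b0).
by rewrite mulrBl mul1r; lra.
Qed.

Definition star n := star_prod (zeros n).

Lemma starE n (e : R[i]) : cabs e = 1 ->
  (star n).[e] = e ^+ n * conjc (Phi n).[e].
Proof. by move=> e1; rewrite /star star_prodE // size_zeros -zerosP. Qed.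

(** On the circle [star n] is e^n conj (Phi_n), so this pairing is the conjugate of that of [Phi n]
    with a power of exponent n - j - 1 < n. *)
Lemma ip_Xn_star n j : (j < n)%N -> ip mu 'X^(j.+1) (star n) = 0.
Proof.
move=> jn; suff -> : ip mu 'X^(j.+1) (star n) = conjc (ip mu 'X^(n - j.+1) (Phi n)).
  by rewrite ip_Xn_OPUC ?conjc0 // ltn_subrL (leq_ltn_trans _ jn).
rewrite -ipC; congr cint; apply/funext => t.
have e1 := cabs_expi t; move: (expi t) e1 => e e1.
rewrite starE // !hornerXn mulrA [RHS]mulrC; congr (_ * _).
have -> : e ^+ n = e ^+ (n - j.+1) * e ^+ j.+1 by rewrite -exprD subnK.
by rewrite mulrCA rmorphXn /= -exprMn mulJ_unit // expr1n mulr1.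
Qed.

Lemma ip_X_star n (q : {poly R[i]}) : (size q <= n)%N -> ip mu ('X * q) (star n) = 0.
Proof.
move=> sq; rewrite -[q]coefK poly_def mulr_sumr ipC ip_sumr big1 ?conjc0 // => i _.
rewrite -scalerAr -exprS ipZr ipC ip_Xn_star ?conjc0 ?mulr0 //.
exact: leq_trans (ltn_ord i) sq.
Qed.

(* The difference D of the two sides vanishes at 0, and D / X has degree < n and is
   orthogonal to itself. *)
Lemma Szego_recursion n :
  Phi n.+1 = 'X * Phi n - conjc (verblunsky Phi n) *: star n.
Proof.
have -> : conjc (verblunsky Phi n) = - (Phi n.+1).[0].
  by rewrite /verblunsky rmorphN /= conjcK.
set c := (Phi n.+1).[0]; rewrite scaleNr opprK.
apply/eqP; rewrite -subr_eq0; apply/eqP; set D := _ - _.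
have D0 : D.[0] = 0.
  rewrite /D hornerD hornerN hornerD hornerM hornerX mul0r add0r hornerZ.
  by rewrite /star star_prod0 mulr1 subrr.
have [m1 [s1 _]] := PhiP n.+1; have [m0 [s0 _]] := PhiP n.
have sD : (size D <= n.+1)%N.
  apply/leq_sizeP => j; rewrite leq_eqVlt => /predU1P[<-|nj].
    rewrite /D coefB coefD coefXM /= coefZ [(star n)`_ _]nth_default; last first.
      by rewrite -{2}(size_zeros n) size_star_prod.
    move: m1 m0; rewrite !monicE !lead_coefE s1 s0 /= => /eqP -> /eqP ->.
    by rewrite mulr0 addr0 subrr.
  have st : (star n)`_j = 0.
    rewrite nth_default // (leq_trans (size_star_prod _)) // size_zeros.
    exact: ltnW.
  rewrite /D coefB coefD coefXM coefZ st mulr0 addr0 [(Phi n.+1)`_j]nth_default ?s1 //.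
  by case: j nj st => // j nj _ /=; rewrite nth_default ?s0 // subr0.
have [E DE] : exists E, D = E * 'X.
  have [E DE] : exists E, D = E * ('X - 0%:P) by apply/factor_theorem/eqP.
  by exists E; rewrite DE subr0.
have sE : (size E <= n)%N.
  have [->|E0] := eqVneq E 0; first by rewrite size_poly0.
  by move: sD; rewrite DE size_mulX.
suff E0 : E = 0 by rewrite DE E0 mul0r.
apply: (ip_definite mu muC muI).
have -> : ip mu E E = ip mu ('X * E) D by rewrite -(ip_mulX mu E E) {2}(mulrC 'X E) -DE.
(* ['X * E] has degree at most n, hence is orthogonal to [Phi n.+1] and to [star n]; the isometry
   turns the remaining term into [ip E (Phi n)], which vanishes too. *)
rewrite /D ipBr ipDr ip_mulX ipZr !ip_OPUC ?ip_X_star // ?mulr0 ?addr0 ?subr0 //.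
by apply: leq_trans (size_polyMleq _ _) _; rewrite size_polyX add2n.
Qed.

(** The recursion conjugated on the circle and multiplied by e^(n+1). *)
Lemma Szego_star n : star n.+1 = star n - verblunsky Phi n *: ('X * Phi n).
Proof.
apply/eqP; rewrite -subr_eq0; apply/eqP; apply: (poly_eq0_circle mu muC muI) => t.
have e1 := cabs_expi t; move: (expi t) e1 => e e1.
rewrite !(hornerD, hornerN, hornerZ, hornerM, hornerX) !starE //.
rewrite Szego_recursion !(hornerD, hornerN, hornerZ, hornerM, hornerX) starE //.
rewrite rmorphB !rmorphM /= !conjcK rmorphXn /= mulrBr exprS.
have ee : e * conjc e = 1 by rewrite mulrC mulJ_unit.
have een : e ^+ n * conjc e ^+ n = 1 by rewrite -exprMn ee expr1n.
move: (verblunsky Phi n) (Phi n).[e] => a p; set u := conjc p.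
rewrite (_ : e * e ^+ n * (conjc e * u) = e ^+ n * (e * conjc e) * u); last by ring.
rewrite (_ : e * e ^+ n * (a * (conjc e ^+ n * p)) =
  (e ^+ n * conjc e ^+ n) * (a * (e * p))); last by ring.
by rewrite ee een; ring.
Qed.

Lemma cabs_verblunskyE n : cabs (verblunsky Phi n) = \prod_(z <- zeros n.+1) cabs z.
Proof.
rewrite /verblunsky cabsN cabsJ zerosP horner_prod cabs_prod.
by apply: eq_bigr => z _; rewrite hornerXsubC sub0r cabsN.
Qed.

Lemma cabs_verblunsky_le1 n : cabs (verblunsky Phi n) <= 1.
Proof.
rewrite cabs_verblunskyE big_seq.
suff /andP[] : 0 <= \prod_(z <- zeros n.+1 | z \in zeros n.+1) cabs z <= 1 by [].
elim/big_ind: _ => [|x y /andP[x0 x1] /andP[y0 y1]|z zn].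
- by rewrite ler01 lexx.
- by rewrite mulr_ge0 //= mulr_ile1.
- by rewrite cabs_ge0 (zeros_le1 _ _ zn).
Qed.

End OPUC.

(** * Power sums of the zeros *)

Section PowerSums.
Context {R : realType}.
Local Notation C := R[i].
Variables (zeros : nat -> seq C) (a : nat -> C).
Let P n : {poly C} := \prod_(z <- zeros n) ('X - z%:P).
Let S n : {poly C} := star_prod (zeros n).
Hypothesis zeros0 : zeros 0%N = [::].
Hypothesis P_rec : forall n, P n.+1 = 'X * P n - conjc (a n) *: S n.
Hypothesis S_rec : forall n, S n.+1 = S n - a n *: ('X * P n).
Hypothesis a_le1 : forall n, cabs (a n) <= 1.

Variable K : nat.

(* All power series are truncated: the relations below hold modulo 'X^K.  As
   S n has constant term 1, the Neumann sum inv n is its inverse. *)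
Let inv n : {poly C} := \sum_(m < K) (1 - S n) ^+ m.
Let B n : {poly C} := P n * inv n.

Lemma dvdXn_coef (p : {poly C}) m : (m < K)%N -> 'X^K %| p -> p`_m = 0.
Proof. by move=> mK /dvdpP[q ->]; rewrite coefMXn mK. Qed.

(** The constant term 1 makes [S n] coprime to ['X^K], so a congruence may be multiplied by [S n]
    before it is checked. *)
Let S_cancel n (p : {poly C}) : 'X^K %| S n * p -> 'X^K %| p.
Proof.
rewrite Gauss_dvdpr //; apply: coprimep_expl.
by rewrite coprimep_sym coprimepX /root /S star_prod0 oner_eq0.
Qed.

(** The geometric sum leaves the remainder (1 - S_n)^K, and X divides 1 - S_n. *)
Let inv_ex n : exists W, S n * inv n = 1 + W * 'X^K.
Proof.
have /dvdpP[q Eq] : 'X %| 1 - S n.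
  rewrite -[X in X %| _]subr0 dvdp_XsubCl /root hornerD hornerN hornerC.
  by rewrite /S star_prod0 subrr.
exists (- q ^+ K); have := subrX1 (1 - S n) K; rewrite -/(inv n) {1}Eq exprMn => e.
have -> : S n * inv n = - ((1 - S n - 1) * inv n) by ring.
by rewrite -e; ring.
Qed.

Let SB n : exists W, S n * B n = P n + W * 'X^K.
Proof.
have [W e] := inv_ex n; exists (P n * W).
by rewrite /B mulrCA e; ring.
Qed.

(** The Schur step b_{n+1} = (z b_n - conj a_n) / (1 - a_n z b_n), cleared of its denominator; it is
    the quotient of the two recursions. *)
Let B_rec n : 'X^K %| B n.+1 * (1 - a n *: ('X * B n)) - ('X * B n - (conjc (a n))%:P).
Proof.
apply: (@S_cancel n); have [W1 e1] := SB n.+1; have [W e] := SB n.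
have := P_rec n; have := S_rec n.
rewrite -!mul_polyC; set A := (a n)%:P; set A' := (conjc _)%:P => sr pr.
apply/dvdpP; exists (W1 + A * 'X * B n.+1 * - W - 'X * W).
have -> : S n * (B n.+1 * (1 - A * ('X * B n)) - ('X * B n - A')) =
  B n.+1 * (S n - A * 'X * (S n * B n)) - 'X * (S n * B n) + A' * S n by ring.
rewrite e.
have -> : S n - A * 'X * (P n + W * 'X^K) = S n.+1 - A * 'X * W * 'X^K by rewrite sr; ring.
have -> : B n.+1 * (S n.+1 - A * 'X * W * 'X^K) =
   S n.+1 * B n.+1 - B n.+1 * (A * 'X * W * 'X^K) by ring.
by rewrite e1 pr; ring.
Qed.

Let B_coef0 n : (0 < K)%N -> (B n.+1)`_0 = - conjc (a n).
Proof.
move=> K0; have := dvdXn_coef _ _ K0 (B_rec n).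
rewrite mulrBr mulr1 -scalerAr !coefB coefZ coefC /= coefXM /=.
by rewrite mulrCA coefXM /= mulr0 subr0 sub0r opprK => /eqP; rewrite addr_eq0 => /eqP.
Qed.

Let B_coefS n m : (m.+1 < K)%N -> (B n.+1)`_m.+1 =
  (B n)`_m + a n * \sum_(j < m.+1) (B n.+1)`_j * (B n)`_(m - j).
Proof.
move=> mK; have := dvdXn_coef _ _ mK (B_rec n).
rewrite mulrBr mulr1 -scalerAr !coefB coefZ coefC /= coefXM /=.
rewrite mulrCA coefXM /= subr0 (coefM (B n.+1)) => /eqP; rewrite subr_eq0 => /eqP <-.
by rewrite subrK.
Qed.

(** Coefficient m + 1 of b_{n+1} involves only coefficients up to m of b_n and b_{n+1}, and |a_n| <=
    1. Induction on m alone thus gives a bound uniform in n. *)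
Let B_bound m : exists2 c : R, 0 <= c &
  forall n i, (i <= m)%N -> (i < K)%N -> cabs (B n)`_i <= c.
Proof.
have B0 i : (i < K)%N -> cabs (B 0%N)`_i <= 1.
  move=> iK; have [W] := SB 0; rewrite /S /P zeros0 /star_prod !big_nil mul1r => ->.
  by rewrite coefD coefMXn iK addr0 coef1; case: eqP; rewrite ?cabs1 ?cabs0 ?ler01.
elim: m => [|m [c c0 IH]].
  exists 1 => // [[|n]] i; rewrite leqn0 => /eqP -> K0; first exact: B0.
  by rewrite B_coef0 // cabsN cabsJ.
(* The 1 covers n = 0, where b_0 = 1; the rest is the shifted coefficient plus m + 1 products in
   [B_coefS]. *)
exists (1 + c + m.+1%:R * c ^+ 2).
  by rewrite !addr_ge0 // mulr_ge0 // sqr_ge0.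
have cle : 1 <= 1 + c + m.+1%:R * c ^+ 2.
  by rewrite -addrA lerDl addr_ge0 // mulr_ge0 // sqr_ge0.
move=> n i; rewrite leq_eqVlt ltnS => /predU1P[->|im] iK; last first.
  apply: le_trans (IH n i im iK) _.
  by rewrite [1 + c]addrC -addrA lerDl addr_ge0 // mulr_ge0 // sqr_ge0.
case: n => [|n]; first exact: le_trans (B0 _ iK) cle.
rewrite B_coefS //; apply: le_trans (ler_cabsD _ _) _; apply: lerD.
  by apply: le_trans (IH n m _ _) _; rewrite ?lerDr //; exact: ltnW.
rewrite cabsM -[leRHS]mul1r; apply: ler_pM; rewrite ?cabs_ge0 //.
apply: le_trans (ler_cabs_sum _ _ _ _) _.
have -> : m.+1%:R * c ^+ 2 = \sum_(j < m.+1) c ^+ 2 by rewrite sumr_const card_ord mulr_natl.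
apply: ler_sum => j _; rewrite cabsM expr2.
have jm : (j <= m)%N by rewrite -ltnS.
apply: ler_pM; rewrite ?cabs_ge0 //.
  by apply: IH => //; exact: leq_ltn_trans (leqW jm) iK.
apply: IH; first exact: leq_subr.
by apply: leq_ltn_trans iK; apply: leq_trans (leq_subr _ _) _.
Qed.

(** The truncated series of f' / f for the factor f = 1 - conj z X. *)
Let geo (z : C) : {poly C} := \poly_(m < K) - conjc z ^+ m.+1.
(* U s is the logarithmic derivative of star_prod s; its coefficients are minus the
   conjugated power sums. *)
Let U s : {poly C} := \sum_(z <- s) geo z.

Let U_star s : exists W, U s * star_prod s = (star_prod s)^`() + W * 'X^K.
Proof.
elim: s => [|z s [W IH]].
  by exists 0; rewrite /U /star_prod !big_nil mul0r derivC mul0r addr0.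
rewrite /U /star_prod !big_cons -/(U s) -/(star_prod s) derivM.
set c := conjc z; set f := 1 - c *: 'X.
have fE : geo z * f = f^`() + (c ^+ K.+1)%:P * 'X^K.
  rewrite /f derivB derivC derivZ derivX sub0r alg_polyC.
  have -> : geo z = - c *: \sum_(m < K) (c *: 'X) ^+ m.
    rewrite /geo poly_def scaler_sumr; apply: eq_bigr => m _.
    by rewrite exprZn scalerA exprS mulNr.
  have := subrX1 (c *: 'X : {poly C}) K; set g := \sum_(m < K) _ => e.
  have -> : (- c *: g) * (1 - c *: 'X) = c *: ((c *: 'X - 1) * g).
    by rewrite -!mul_polyC polyCN; ring.
  rewrite -e exprZn scalerBr scalerA -exprS -!mul_polyC mulr1; ring.
exists ((c ^+ K.+1)%:P * star_prod s + f * W).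
have -> : (geo z + U s) * (f * star_prod s) =
   (geo z * f) * star_prod s + f * (U s * star_prod s) by ring.
by rewrite fE IH; ring.
Qed.

Let D n := U (zeros n.+1) - U (zeros n).
(** The ratio of [S n.+1] to [S n] as truncated series, so that [D n] is its logarithmic
    derivative. *)
Let T n := 1 - a n *: ('X * B n).

Let D_rec n : 'X^K %| D n * T n - (T n)^`().
Proof.
apply: (@S_cancel n); have [W e] := SB n.
have [V1] := U_star (zeros n.+1); have [V0] := U_star (zeros n).
rewrite -!/(S _) => e0 e1.
(* The factor ['X] before [B n] gains one order; differentiation then loses it and the relation
   stays valid modulo ['X^K]. *)
have ST : S n.+1 = S n * T n + (a n *: W) * 'X^(K.+1).
  rewrite S_rec /T -!mul_polyC exprS.
  have -> : S n * (1 - (a n)%:P * ('X * B n)) = S n - (a n)%:P * 'X * (S n * B n) by ring.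
  by rewrite e; ring.
have dST : (S n.+1)^`() = (S n)^`() * T n + S n * (T n)^`() +
    ((a n *: W)^`() * 'X + (a n *: W) * (K.+1%:R)%:P) * 'X^K.
  rewrite ST derivD !derivM derivXn /= -mulr_natl polyC_natr exprS; ring.
apply/dvdpP; exists (V1 - T n * V0 + ((a n *: W)^`() * 'X + (a n *: W) * (K.+1%:R)%:P) -
   U (zeros n.+1) * (a n *: W) * 'X).
have -> : S n * (D n * T n - (T n)^`()) = U (zeros n.+1) * (S n * T n) -
   T n * (U (zeros n) * S n) - S n * (T n)^`() by rewrite /D; ring.
have -> : S n * T n = S n.+1 - (a n *: W) * 'X^(K.+1) by rewrite ST; ring.
have -> : U (zeros n.+1) * (S n.+1 - a n *: W * 'X^(K.+1)) =
   U (zeros n.+1) * S n.+1 - U (zeros n.+1) * (a n *: W * 'X^(K.+1)) by ring.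
by rewrite e1 e0 dST exprS; ring.
Qed.

Let D_coef n m : (m < K)%N -> (D n)`_m =
  a n * (\sum_(j < m) (D n)`_j * (B n)`_(m.-1 - j)) - a n * (B n)`_m *+ m.+1.
Proof.
move=> mK; have := dvdXn_coef _ _ mK (D_rec n).
rewrite /T mulrBr mulr1 -scalerAr !coefB coefZ mulrCA coefXM.
rewrite derivB derivC sub0r derivZ coefN coefZ coef_deriv coefXM /= opprK.
rewrite -mulrnAr => /eqP; rewrite addr_eq0 subr_eq => /eqP ->.
rewrite addrC; congr (_ * _ - _); case: m mK => [|m] mK /=; first by rewrite big_ord0.
by rewrite coefM.
Qed.

(** Both terms of [D_coef] carry the factor [a n]; the other factors are bounded by [B_bound] and by
    induction on m. *)
Let D_bound m : exists2 c : R, 0 <= c &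
  forall n i, (i <= m)%N -> (i < K)%N -> cabs (D n)`_i <= c * cabs (a n).
Proof.
have step i n (c b : R) : 0 <= c -> 0 <= b -> (i < K)%N ->
    (forall j, (j < i)%N -> cabs (D n)`_j <= c * cabs (a n)) ->
    (forall j, (j <= i)%N -> cabs (B n)`_j <= b) ->
    cabs (D n)`_i <= (i%:R * (c * b) + i.+1%:R * b) * cabs (a n).
  move=> c0 b0 iK hD hB; rewrite D_coef // -mulrnAr.
  apply: le_trans (ler_cabsB _ _) _; rewrite !cabsM -mulrDr mulrC.
  apply: ler_wpM2r; first exact: cabs_ge0.
  apply: lerD; last first.
    rewrite -mulr_natr cabsM mulrC -(rmorph_nat (real_complex R)) cabs_real ger0_norm //.
    by apply: ler_wpM2l => //; exact: hB.
  apply: le_trans (ler_cabs_sum _ _ _ _) _.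
  have -> : i%:R * (c * b) = \sum_(j < i) c * b by rewrite sumr_const card_ord mulr_natl.
  apply: ler_sum => j _; rewrite cabsM; apply: ler_pM; rewrite ?cabs_ge0 //.
    by apply: le_trans (hD _ (ltn_ord j)) _; rewrite ler_piMr.
  by apply: hB; apply: leq_trans (leq_subr _ _) (leq_pred _).
elim: m => [|m [c c0 IH]].
  have [b b0 hb] := B_bound 0; exists (0%:R * (0 * b) + 1%:R * b).
    by rewrite mul0r add0r mul1r.
  by move=> n i; rewrite leqn0 => /eqP -> K0; apply: step => // j j0; exact: hb (leq_ltn_trans j0 K0).
have [b b0 hb] := B_bound m.+1.
have c'0 : 0 <= m.+1%:R * (c * b) + m.+2%:R * b.
  by rewrite addr_ge0 // mulr_ge0 // mulr_ge0.
exists (c + (m.+1%:R * (c * b) + m.+2%:R * b)); first exact: addr_ge0.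
move=> n i; rewrite leq_eqVlt ltnS => /predU1P[->|im] iK.
  rewrite mulrDl; apply: le_trans (step _ _ _ _ c0 b0 iK _ _) _.
  - by move=> j jm; apply: IH => //; exact: ltn_trans iK.
  - by move=> j jm; apply: hb => //; exact: leq_ltn_trans iK.
  - by rewrite lerDr mulr_ge0 // cabs_ge0.
rewrite mulrDl; apply: le_trans (IH n i im iK) _.
by rewrite lerDl mulr_ge0 // cabs_ge0.
Qed.

(** Coefficient m of [U] starts at 0 for n = 0 and changes by at most c |a_j| at step j; the power
    sum is minus its conjugate. *)
Lemma power_sum_bound_aux m : (m < K)%N -> exists2 c : R, 0 <= c &
  forall n, cabs (\sum_(z <- zeros n) z ^+ m.+1) <= c * \sum_(j < n) cabs (a j).
Proof.
move=> mK; have [c c0 hc] := D_bound m; exists c => // n.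
have -> : cabs (\sum_(z <- zeros n) z ^+ m.+1) = cabs (U (zeros n))`_m.
  rewrite /U coef_sum -cabsJ -cabsN rmorph_sum /= -sumrN; congr cabs.
  by apply: eq_bigr => z _; rewrite coef_poly mK rmorphXn.
elim: n => [|n IHn].
  by rewrite /U zeros0 !big_nil big_ord0 coef0 cabs0 mulr0.
have -> : U (zeros n.+1) = U (zeros n) + D n by rewrite /D addrC subrK.
rewrite big_ord_recr mulrDr coefD; apply: le_trans (ler_cabsD _ _) _.
by apply: lerD => //; exact: hc.
Qed.

End PowerSums.

Section PowerSumsOPUC.
Context {R : realType} (mu : probability R R) (Phi : nat -> {poly R[i]}).
Variable zeros : nat -> seq R[i].
Hypotheses (muC : circle_prob mu) (muI : nontrivial mu).
Hypothesis PhiP : is_monic_OPUC mu Phi.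
Hypothesis zerosP : forall n, Phi n = \prod_(z <- zeros n) ('X - z%:P).

Lemma power_sum_bound m : exists2 c : R, 0 <= c &
  forall n, cabs (\sum_(z <- zeros n) z ^+ m.+1) <=
    c * \sum_(j < n) cabs (verblunsky Phi j).
Proof.
apply: (@power_sum_bound_aux _ _ _ _ _ _ _ m.+1) => //.
- exact: size0nil (size_zeros _ _ _ PhiP zerosP 0).
- by move=> n; rewrite -!zerosP; exact: Szego_recursion _ _ _ muC muI PhiP zerosP n.
- by move=> n; rewrite -!zerosP; exact: Szego_star _ _ _ muC muI PhiP zerosP n.
- exact: cabs_verblunsky_le1 _ _ _ muC muI PhiP zerosP.
Qed.

End PowerSumsOPUC.

(** * Jensen's inequality on roots of unity *)

Section RootsOfUnity.
Context {R : realType}.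

Definition unit_root M (j : nat) : R[i] := expi (j%:R * (2 * pi / M%:R)).

Lemma cabs_unit_root M j : cabs (unit_root M j) = 1.
Proof. exact: cabs_expi. Qed.

Lemma unit_rootE M j : unit_root M j = unit_root M 1 ^+ j.
Proof. by rewrite /unit_root mul1r expi_natr. Qed.

(** A geometric sum whose ratio has M-th power 1 and, since 0 < k < M, differs from 1. *)
Lemma sum_unit_rootX M k : (0 < k < M)%N -> \sum_(j < M) unit_root M j ^+ k = 0.
Proof.
move=> /andP[k0 kM]; have M0 : (0 < M)%N by exact: leq_ltn_trans kM.
have pi0 : (0 : R) < 2 * pi by rewrite mulr_gt0 // pi_gt0.
have M0' : (0 : R) < M%:R by rewrite ltr0n.
have w1 : unit_root M 1 ^+ k != 1.
  rewrite -unit_rootE; apply/eqP => wk1.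
  suff /eqP : k%:R * (2 * pi / M%:R) = 0 :> R.
    by rewrite gt_eqF // mulr_gt0 ?ltr0n // divr_gt0.
  apply: expi_inj; rewrite ?lexx ?pi0 //.
    rewrite mulr_ge0 ?divr_ge0 ?(ltW pi0) //= mulrCA gtr_pMr //.
    by rewrite ltr_pdivrMr // mul1r ltr_nat.
  by rewrite -/(unit_root M k) wk1 /expi cos0 sin0.
have wM : unit_root M 1 ^+ M = 1.
  rewrite -unit_rootE /unit_root mulrC divfK ?gt_eqF //.
  by rewrite /expi mulr_natl cos2pi sin2pi.
have /esym/eqP := subrX1 (unit_root M 1 ^+ k) M.
rewrite -exprM mulnC exprM wM expr1n subrr mulf_eq0 subr_eq0 (negPf w1) /= => /eqP sum0.
by rewrite -[RHS]sum0; apply: eq_bigr => j _; rewrite unit_rootE -!exprM mulnC.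
Qed.

(** A discrete mean value property: with degree below M, only the constant coefficient survives the
    averaging. *)
Lemma horner0_mean (p : {poly R[i]}) M : (size p <= M)%N ->
  p.[0] *+ M = \sum_(j < M) p.[unit_root M j].
Proof.
move=> sp; under eq_bigr do rewrite (horner_coef_wide _ sp).
rewrite exchange_big /=; case: M sp => [|M] sp; first by rewrite big_ord0 mulr0n.
rewrite big_ord_recl /= [X in _ + X]big1 ?addr0 => [|i _].
  by under eq_bigr do rewrite expr0 mulr1; rewrite sumr_const card_ord horner_coef0.
by rewrite -mulr_sumr sum_unit_rootX ?mulr0 //= ltnS.
Qed.

Lemma cabs_reflect (e z : R[i]) : cabs e = 1 -> cabs (1 - conjc z * e) = cabs (e - z).
Proof.
move=> e1; have -> : 1 - conjc z * e = e * conjc (e - z).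
  by rewrite rmorphB /= mulrBr (mulrC e) mulJ_unit // (mulrC e).
by rewrite cabsM e1 mul1r cabsJ.
Qed.

(* Each zero inside the disc is reflected to its inverse conjugate, which leaves the
   modulus on the circle unchanged; the new polynomial has no zero inside the disc
   and its value at 0 is a mean over roots of unity. *)
Lemma Jensen_bound (s : seq R[i]) (A : R) :
  (forall e, cabs e = 1 -> \prod_(z <- s) cabs (e - z) <= A) ->
  \prod_(z <- s) Num.max 1 (cabs z) <= A.
Proof.
move=> hA; pose f (z : R[i]) : {poly R[i]} :=
  if cabs z <= 1 then 1 - conjc z *: 'X else 'X - z%:P.
pose Q : {poly R[i]} := \prod_(z <- s) f z.
have sf z : (size (f z) <= 2)%N.
  rewrite /f; case: ifP => _; last by rewrite size_XsubC.
  apply: leq_trans (size_polyD _ _) _; rewrite geq_max size_poly1 size_polyN.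
  by rewrite (leq_trans (size_scale_leq _ _)) // size_polyX.
have sQ : (size Q <= (size s).+1)%N.
  rewrite /Q; elim: (s) => [|z s' IHs]; first by rewrite big_nil size_poly1.
  rewrite big_cons; apply: leq_trans (size_polyMleq _ _) _.
  by rewrite -subn1 leq_subLR; exact: leq_add (sf z) IHs.
have Q0 : cabs Q.[0] = \prod_(z <- s) Num.max 1 (cabs z).
  rewrite /Q horner_prod cabs_prod; apply: eq_bigr => z _; rewrite /f.
  case: leP => z1; last by rewrite hornerXsubC sub0r cabsN.
  by rewrite hornerD hornerN hornerZ hornerX hornerC mulr0 subr0 cabs1.
have Qe e : cabs e = 1 -> cabs Q.[e] = \prod_(z <- s) cabs (e - z).
  move=> e1; rewrite /Q horner_prod cabs_prod; apply: eq_bigr => z _; rewrite /f.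
  case: leP => z1; last by rewrite hornerXsubC.
  by rewrite hornerD hornerN hornerZ hornerX hornerC cabs_reflect.
have /(congr1 cabs) := horner0_mean _ _ sQ.
rewrite -mulr_natr cabsM -(rmorph_nat (real_complex R)) cabs_real ger0_norm // Q0 => e.
have M0 : (0 : R) < (size s).+1%:R by rewrite ltr0n.
rewrite -(ler_pM2r M0) e; apply: le_trans (ler_cabs_sum _ _ _ _) _.
have -> : A * (size s).+1%:R = \sum_(j < (size s).+1) A.
  by rewrite sumr_const card_ord mulr_natr.
apply: ler_sum => j _; rewrite Qe ?cabs_unit_root //; apply: hA.
exact: cabs_unit_root.
Qed.

End RootsOfUnity.

(** * Growth of the orthogonal polynomials on smaller circles *)

Section Radial.
Context {R : realType} (mu : probability R R) (Phi : nat -> {poly R[i]}).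
Variable zeros : nat -> seq R[i].
Hypotheses (muC : circle_prob mu) (muI : nontrivial mu).
Hypothesis PhiP : is_monic_OPUC mu Phi.
Hypothesis zerosP : forall n, Phi n = \prod_(z <- zeros n) ('X - z%:P).

Local Notation a n := (cabs (verblunsky Phi n)).
Let size_zeros n : size (zeros n) = n.
Proof. exact: (size_zeros _ _ _ PhiP zerosP n). Qed.

(** With x = rho^{-n} |Phi_n| and y the modulus of the reversal, the recursion adds at most
    rho^{-n-1} a_n y to x and rho^{n+1} a_n x to y. As rho <= 1, both are covered by the factor 1 +
    rho^{-n-1} a_n. At n = 0 the sum x + y is 2. *)
Lemma OPUC_growth (rho : R) n (e : R[i]) : 0 < rho -> rho <= 1 -> cabs e = 1 ->
  rho ^- n * cabs (Phi n).[rho%:C%C * e] + cabs (star_prod (zeros n)).[rho%:C%C * e] <=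
  2 * \prod_(j < n) (1 + rho ^- j.+1 * a j).
Proof.
move=> r0 r1 e1; elim: n => [|n IHn].
  rewrite big_ord0 zerosP /star_prod (size0nil (size_zeros 0)) !big_nil !hornerC.
  by rewrite cabs1 expr0 invr1; lra.
rewrite big_ord_recr /= mulrA; set z := rho%:C%C * e in IHn *.
have z1 : cabs z = rho by rewrite cabsM e1 mulr1 cabs_real gtr0_norm.
clearbody z; clear e1.
have := Szego_star _ _ _ muC muI PhiP zerosP n; rewrite /star => ->.
rewrite (Szego_recursion _ _ _ muC muI PhiP zerosP n) /star.
rewrite !(hornerD, hornerN, hornerZ, hornerM, hornerX).
set x := (Phi n).[z] in IHn *; set y := (star_prod _).[z] in IHn *.
have rn : 0 < rho ^- n.+1 by rewrite invr_gt0 exprn_gt0.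
have rn' : rho ^- n.+1 * rho = rho ^- n.
  by rewrite exprS invfM mulrAC mulVf ?mul1r // gt_eqF.
have h1 : cabs (z * x - conjc (verblunsky Phi n) * y) <= rho * cabs x + a n * cabs y.
  by apply: le_trans (ler_cabsB _ _) _; rewrite !cabsM z1 cabsJ.
have h2 : cabs (y - verblunsky Phi n * (z * x)) <= cabs y + a n * (rho * cabs x).
  by apply: le_trans (ler_cabsB _ _) _; rewrite !cabsM z1.
have h3 : rho * cabs x <= rho ^- n.+1 * (rho ^- n * cabs x).
  rewrite mulrA; apply: ler_wpM2r; rewrite ?cabs_ge0 //.
  apply: (le_trans r1); rewrite -invfM -exprD invf_ge1 ?exprn_gt0 //.
  by rewrite exprn_ile1 // ltW.
have h4 := ler_wpM2l (ltW rn) h1.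
have h5 := ler_wpM2l (cabs_ge0 (verblunsky Phi n)) h3.
have h6 : 0 <= rho ^- n.+1 * a n by rewrite mulr_ge0 ?cabs_ge0 // ltW.
have h7 : 0 <= 1 + rho ^- n.+1 * a n by lra.
have h8 := ler_wpM2r h7 IHn.
rewrite mulrDr !mulrA rn' in h4.
apply: le_trans h8; apply: le_trans (lerD h4 h2) _.
rewrite mulrA in h5.
by rewrite !mulrDr !mulrDl !mulr1 /=; move: h5; rewrite !mulrA; lra.
Qed.

Definition log_excess (rho : R) n := \sum_(z <- zeros n) ln (Num.max 1 (cabs z / rho)).

(** Jensen's bound for the zeros divided by rho, whose product over the circle is rho^{-n} |Phi_n
    (rho e)|, followed by 1 + x <= exp x. *)
Lemma log_excess_le (rho : R) n : 0 < rho -> rho <= 1 ->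
  log_excess rho n <= ln 2 + \sum_(j < n) rho ^- j.+1 * a j.
Proof.
move=> r0 r1.
have mx (z : R[i]) : 0 < Num.max 1 (cabs z / rho) by rewrite lt_max ltr01.
have mxp (s : seq R[i]) : 0 < \prod_(z <- s) Num.max 1 (cabs z / rho).
  by elim/big_ind: _ => // x y; exact: mulr_gt0.
have -> : log_excess rho n = ln (\prod_(z <- zeros n) Num.max 1 (cabs z / rho)).
  rewrite /log_excess; elim: (zeros n) => [|z s IHs]; first by rewrite !big_nil ln1.
  by rewrite !big_cons lnM ?posrE // IHs.
have le2 : \prod_(z <- zeros n) Num.max 1 (cabs z / rho) <=
    2 * \prod_(j < n) (1 + rho ^- j.+1 * a j).
  have -> : \prod_(z <- zeros n) Num.max 1 (cabs z / rho) =
     \prod_(z <- [seq z / rho%:C%C | z <- zeros n]) Num.max 1 (cabs z).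
    rewrite big_map; apply: eq_bigr => z _.
    by rewrite cabsM -fmorphV cabs_real gtr0_norm // invr_gt0.
  apply: Jensen_bound => e e1; apply: le_trans (OPUC_growth _ n _ r0 r1 e1).
  rewrite -[leLHS]addr0; apply: lerD; rewrite ?cabs_ge0 //.
  rewrite big_map zerosP horner_prod cabs_prod.
  have -> : rho ^- n = rho ^- size (zeros n) by rewrite size_zeros.
  elim: (zeros n) => [|z s IHs]; first by rewrite !big_nil expr0 invr1 mul1r.
  rewrite !big_cons /= exprS invfM mulrACA; apply: ler_pM; rewrite ?cabs_ge0 //.
    by rewrite prodr_ge0 // => z' _; exact: cabs_ge0.
  rewrite hornerXsubC -[rho^-1]gtr0_norm ?invr_gt0 // -cabs_real -cabsM fmorphV /=.
  by rewrite mulrBr mulKf ?[_^-1 * z]mulrC // fmorph_eq0 gt_eqF.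
have le3 : \prod_(j < n) (1 + rho ^- j.+1 * a j) <=
    expR (\sum_(j < n) rho ^- j.+1 * a j).
  rewrite expR_sum; apply: ler_prod => j _; rewrite expR_ge1Dx andbT.
  by rewrite addr_ge0 // mulr_ge0 ?cabs_ge0 // invr_ge0 exprn_ge0 // ltW.
rewrite -[X in _ <= _ + X]expRK -lnM ?posrE ?expR_gt0 //.
rewrite ler_ln ?posrE ?mulr_gt0 ?expR_gt0 //.
by apply: le_trans le2 _; rewrite ler_pM2l.
Qed.

End Radial.

(** * Concentration of the moduli of the zeros *)

Lemma cvg0Ml {R : realType} (c : R) (u : nat -> R) : u @ \oo --> (0 : R) ->
  (fun n => c * u n) @ \oo --> (0 : R).
Proof. by move=> u0; rewrite -[X in _ --> X](mulr0 c); exact: cvgMl_tmp. Qed.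

Lemma cvg0D {R : realType} (u v : nat -> R) :
  u @ \oo --> (0 : R) -> v @ \oo --> (0 : R) -> (fun n => u n + v n) @ \oo --> (0 : R).
Proof. by move=> u0 v0; have h := cvgD u0 v0; rewrite addr0 in h; exact: h. Qed.

Section ZeroAverages.
Context {R : realType}.
Variable zeros : nat -> seq R[i].

(** The integral of F against nu_n; at n = 0 the inverse of 0 makes it 0. *)
Definition zavg (F : R[i] -> R) n := n%:R^-1 * \sum_(z <- zeros n) F z.

Lemma ler_zavg F G n : (forall z, z \in zeros n -> F z <= G z) ->
  zavg F n <= zavg G n.
Proof.
move=> FG; rewrite /zavg ler_wpM2l ?invr_ge0 // !big_seq.
exact: ler_sum.
Qed.

Lemma zavg_ge0 F n : (forall z, 0 <= F z) -> 0 <= zavg F n.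
Proof. by move=> F0; rewrite /zavg mulr_ge0 ?invr_ge0 ?sumr_ge0. Qed.

Lemma zavgD F G n : zavg (fun z => F z + G z) n = zavg F n + zavg G n.
Proof. by rewrite /zavg big_split mulrDr. Qed.

Lemma zavgZ c F n : zavg (fun z => c * F z) n = c * zavg F n.
Proof. by rewrite /zavg -mulr_sumr mulrCA. Qed.

Lemma zavg_norm F n : `|zavg F n| <= zavg (fun z => `|F z|) n.
Proof.
rewrite /zavg normrM ger0_norm ?invr_ge0 //.
by rewrite ler_wpM2l ?invr_ge0 // ler_norm_sum.
Qed.

Lemma zavg_sum (I : Type) (s : seq I) (F : I -> R[i] -> R) n :
  zavg (fun z => \sum_(i <- s) F i z) n = \sum_(i <- s) zavg (F i) n.
Proof. by rewrite /zavg exchange_big /= mulr_sumr. Qed.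

End ZeroAverages.

Section Concentration.
Context {R : realType} (mu : probability R R) (Phi : nat -> {poly R[i]}).
Variables (zeros : nat -> seq R[i]) (r : R).
Hypotheses (muC : circle_prob mu) (muI : nontrivial mu).
Hypothesis PhiP : is_monic_OPUC mu Phi.
Hypothesis zerosP : forall n, Phi n = \prod_(z <- zeros n) ('X - z%:P).
Local Notation a n := (cabs (verblunsky Phi n)).
Local Notation avg := (zavg zeros).
Hypothesis root_a : (fun n : nat => a n `^ (n%:R^-1)) @ \oo --> r.

Let size_zeros n : size (zeros n) = n.
Proof. exact: (size_zeros _ _ _ PhiP zerosP n). Qed.

Let le1 n z : z \in zeros n -> cabs z <= 1.
Proof. exact: (zeros_le1 _ _ _ muC muI PhiP zerosP). Qed.

Let a_le1 n : a n <= 1.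
Proof. exact: (cabs_verblunsky_le1 _ _ _ muC muI PhiP zerosP). Qed.

Lemma zavg_cst c : \forall n \near \oo, avg (fun=> c) n = c.
Proof.
near=> n; rewrite /zavg big_const_seq count_predT size_zeros iter_addr_0.
rewrite -[c *+ n]mulr_natr mulrCA mulVf ?mulr1 // pnatr_eq0 -lt0n.
by near: n; exists 1%N.
Unshelve. all: by end_near. Qed.

Lemma rate_ge0 : 0 <= r.
Proof.
rewrite leNgt; apply/negP => r0.
have [N _ /(_ N (leqnn N))] := cvgr_lt _ root_a _ r0.
by rewrite /= ltNge powR_ge0.
Qed.

Let root_powRK n (x : R) : (0 < n)%N -> 0 <= x -> (x `^ n%:R^-1) ^+ n = x.
Proof.
move=> n0 x0; rewrite -powR_mulrn ?powR_ge0 // -powRrM mulVf ?powRr1 //.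
by rewrite pnatr_eq0 -lt0n.
Qed.

Lemma verblunsky_lt_exp b : r < b -> \forall n \near \oo, a n <= b ^+ n.
Proof.
move=> rb; have b0 : 0 < b by exact: le_lt_trans rate_ge0 rb.
near=> n; have n0 : (0 < n)%N by near: n; exists 1%N.
have h : a n `^ n%:R^-1 <= b by near: n; exact: cvgr_le _ root_a _ rb.
by rewrite -(root_powRK _ _ n0 (cabs_ge0 _)) lerXn2r ?nnegrE ?powR_ge0 // ltW.
Unshelve. all: by end_near. Qed.

Lemma verblunsky_gt_exp b : 0 <= b -> b < r -> \forall n \near \oo, b ^+ n <= a n.
Proof.
move=> b0 rb; near=> n; have n0 : (0 < n)%N by near: n; exists 1%N.
have h : b <= a n `^ n%:R^-1 by near: n; exact: cvgr_ge _ root_a _ rb.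
by rewrite -(root_powRK _ _ n0 (cabs_ge0 _)) lerXn2r ?nnegrE ?powR_ge0.
Unshelve. all: by end_near. Qed.

(** For rho < 1 the terms rho^{-j-1} a_j tend to 0, because a_j <= b^j eventually for some b between
    r and rho, and then so do their Cesaro means. For rho >= 1 every logarithm is ln 1. *)
Lemma log_excess_cvg rho : r < rho ->
  (fun n => n%:R^-1 * log_excess zeros rho n) @ \oo --> (0 : R).
Proof.
move=> rrho; have rho0 : 0 < rho by exact: le_lt_trans rate_ge0 rrho.
have LE0 n : 0 <= log_excess zeros rho n.
  by apply: sumr_ge0 => z _; rewrite ln_ge0 // le_max lexx.
have [rho1|rho1] := leP 1 rho.
  rewrite [X in X @ _ --> _](_ : _ = fun=> 0); first exact: cvg_cst.
  apply/funext => n; rewrite /log_excess big_seq big1 ?mulr0 // => z zn.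
  have /max_idPl -> : cabs z / rho <= 1 by rewrite ler_pdivrMr // mul1r (le_trans (le1 _ _ zn)).
  by rewrite ln1.
pose beta j := rho ^- j.+1 * a j.
have beta0 : beta @ \oo --> (0 : R).
  pose b := (r + rho) / 2.
  have [rb br] : r < b /\ b < rho by rewrite /b; split; lra.
  have b0 : 0 < b by exact: le_lt_trans rate_ge0 rb. clearbody b.
  have geo0 : (fun n : nat => rho^-1 * (b / rho) ^+ n) @ \oo --> (0 : R).
    apply/cvg0Ml/cvg_expr; rewrite ger0_norm ?divr_ge0 ?(ltW b0) ?(ltW rho0) //.
    by rewrite ltr_pdivrMr // mul1r.
  apply: (squeeze_cvgr _ (cvg_cst 0) geo0).
  near=> n; rewrite /beta mulr_ge0 ?cabs_ge0 ?invr_ge0 ?exprn_ge0 ?(ltW rho0) //=.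
  rewrite exprS invfM exprMn exprVn -mulrA; apply: ler_wpM2l; rewrite ?invr_ge0 ?(ltW rho0) //.
  rewrite [leLHS]mulrC; apply: ler_wpM2r; rewrite ?invr_ge0 ?exprn_ge0 ?(ltW rho0) //.
  by near: n; exact: verblunsky_lt_exp.
have mean0 : (fun n : nat => n%:R^-1 * \sum_(j < n) beta j) @ \oo --> (0 : R).
  rewrite -cvg_shiftS.
  rewrite [X in X @ _ --> _](_ : _ = arithmetic_mean beta); first exact: cesaro.
  by apply/funext => n; rewrite /arithmetic_mean /series /= big_mkord.
have inv0 : (fun n : nat => n%:R^-1 * ln 2) @ \oo --> (0 : R).
  rewrite -[X in _ --> X](mul0r (ln 2)); apply: cvgMr_tmp.
  by rewrite -cvg_shiftS; exact: cvg_harmonic.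
have bound0 : (fun n : nat => n%:R^-1 * (ln 2 + \sum_(j < n) beta j)) @ \oo --> (0 : R).
  have h := cvg0D _ _ inv0 mean0.
  by under eq_fun do rewrite mulrDr.
apply: (squeeze_cvgr _ (cvg_cst 0) bound0).
near=> n; rewrite mulr_ge0 ?invr_ge0 //= ler_wpM2l ?invr_ge0 //.
exact: (log_excess_le _ _ _ muC muI PhiP zerosP _ _ rho0 (ltW rho1)).
Unshelve. all: by end_near. Qed.

(** Markov's inequality: with rho between r and b, each zero of modulus at least b adds at least ln
    (b / rho) > 0 to the excess. *)
Lemma zeros_outside_cvg b : r < b ->
  avg (fun z => (b <= cabs z)%R%:R) @ \oo --> (0 : R).
Proof.
move=> rb; pose rho := (r + b) / 2.
have [rr rhob] : r < rho /\ rho < b by rewrite /rho; split; lra.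
have rho0 : 0 < rho by exact: le_lt_trans rate_ge0 rr.
have l0 : 0 < ln (b / rho) by rewrite ln_gt0 // ltr_pdivlMr // mul1r.
have h := cvg0Ml (ln (b / rho))^-1 _ (log_excess_cvg _ rr).
apply: (squeeze_cvgr _ (cvg_cst 0) h).
near=> n; rewrite zavg_ge0 //= mulrCA /log_excess mulr_sumr; apply: ler_zavg => z zn.
rewrite mulrC ler_pdivlMr //; case: (leP b (cabs z)) => bz; last first.
  by rewrite /= mulr0n mul0r ln_ge0 // le_max lexx.
have bz' : b / rho <= cabs z / rho by rewrite ler_wpM2r // invr_ge0 ltW.
have b1 : 1 < b / rho by rewrite ltr_pdivlMr // mul1r.
rewrite /= mulr1n mul1r ler_ln ?posrE ?lt_max ?ltr01 //; first by rewrite le_max bz' orbT.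
exact: lt_trans b1.
Unshelve. all: by end_near. Qed.

(** The mean of ln |z| over the zeros is ln |alpha_n| / (n + 1), close to ln r. Since the excess
    above rho is negligible, few zeros can have a modulus well below r. *)
Lemma zeros_inside_cvg b : 0 < r -> b < r ->
  avg (fun z => (cabs z <= b)%R%:R) @ \oo --> (0 : R).
Proof.
wlog b0 : b / 0 < b => [W r0 br|r0 br].
  have h : 0 < Num.max b (r / 2) by rewrite lt_max divr_gt0 ?orbT.
  have hr : Num.max b (r / 2) < r by rewrite gt_max br /=; lra.
  apply: (squeeze_cvgr _ (cvg_cst 0) (W _ h r0 hr)).
  near=> n; rewrite zavg_ge0 //=; apply: ler_zavg => z _.
  by rewrite ler_nat le_max; case: (cabs z <= b).
have l0 : 0 < ln (r / b) by rewrite ln_gt0 // ltr_pdivlMr // mul1r.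
(* The shift is there because [a n] is the product of the moduli of the zeros of [Phi n.+1]. *)
rewrite -cvg_shiftS; apply/cvgr0Pnorm_le => e e0.
(* With rho = r (1 + eta) and r' = r / (1 + eta), the gap ln rho - ln r' is at most 2 eta, hence at
   most half of the error e ln (r / b). *)
pose eta := Num.min (e * ln (r / b) / 4) ((r / b - 1) / 2).
have rb1 : 1 < r / b by rewrite ltr_pdivlMr // mul1r.
have eta0 : 0 < eta by rewrite lt_min !mulr_gt0 ?invr_gt0 //=; lra.
have etae : eta <= e * ln (r / b) / 4 by rewrite ge_min lexx.
have etab : 1 + eta < r / b.
  have : eta <= (r / b - 1) / 2 by rewrite ge_min lexx orbT.
  lra.
have eta1 : 0 < 1 + eta by lra.
pose rho := r * (1 + eta); pose r' := r / (1 + eta).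
have r_rho : r < rho by rewrite /rho ltr_pMr //; lra.
have r'_r : r' < r by rewrite /r' ltr_pdivrMr // ltr_pMr //; lra.
have rho0 : 0 < rho by exact: lt_trans r_rho.
have r'0 : 0 < r' by rewrite divr_gt0.
have ln_ratio : ln rho - ln r' <= e * ln (r / b) / 2.
  rewrite /rho /r' lnM ?posrE // ln_div ?posrE //.
  have /le_ln1Dx : -1 < eta by lra.
  move: etae; lra.
have := log_excess_cvg _ r_rho; rewrite -cvg_shiftS => hL.
have eL0 : 0 < e * ln (r / b) / 2 by rewrite !mulr_gt0.
near=> n; have n0 : (0 < n)%N by near: n; exists 1%N.
have r'n : r' ^+ n <= a n by near: n; exact: verblunsky_gt_exp (ltW r'0) r'_r.
have Ln : n.+1%:R^-1 * log_excess zeros rho n.+1 <= e * ln (r / b) / 2.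
  by near: n; exact: cvgr_le _ hL _ eL0.
have n1 : (0 : R) < n.+1%:R by rewrite ltr0n.
have r'1 : r' <= 1 by rewrite -(@expr_le1 _ n) ?(ltW r'0) // (le_trans r'n).
have an0 : 0 < a n by apply: lt_le_trans r'n; rewrite exprn_gt0.
have z0 z : z \in zeros n.+1 -> 0 < cabs z.
  move=> zn; rewrite lt_def cabs_ge0 andbT cabs_eq0; apply: contraTneq an0 => z0.
  rewrite (cabs_verblunskyE _ _ zerosP) (big_rem _ zn) /= z0 cabs0 mul0r ltxx //.
have sum_ln : \sum_(z <- zeros n.+1) ln (cabs z) = ln (a n).
  rewrite (cabs_verblunskyE _ _ zerosP).
  elim: (zeros n.+1) z0 => [|z s IHs] z0; first by rewrite !big_nil ln1.
  have sz0 z' : z' \in s -> 0 < cabs z' by move=> h; apply: z0; rewrite inE h orbT.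
  rewrite !big_cons lnM ?posrE ?z0 ?mem_head ?IHs //.
  by rewrite big_seq; elim/big_ind: _ => // x y; exact: mulr_gt0.
rewrite ger0_norm ?zavg_ge0 // -(ler_pM2r l0) mulrC -zavgZ.
(* The new summand is nonnegative everywhere and at least ln (r / b) where |z| <= b. *)
apply: (@le_trans _ _ (avg (fun z => ln (Num.max 1 (cabs z / rho)) + (ln rho - ln (cabs z))) n.+1)).
  apply: ler_zavg => z /z0 zp; case: (leP (cabs z) b) => bz; last first.
    rewrite /= mulr0n mulr0 -opprB -ln_div ?posrE // subr_ge0.
    by rewrite ler_ln ?posrE ?divr_gt0 // ?lt_max ?ltr01 // le_max lexx orbT.
  rewrite /= mulr1n mulr1 -[leLHS]add0r; apply: lerD; first by rewrite ln_ge0 // le_max lexx.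
  rewrite ln_div ?posrE //; apply: lerB; rewrite ler_ln ?posrE //; exact: ltW.
rewrite zavgD [X in _ + X]/zavg sumrB sum_ln big_const_seq count_predT size_zeros iter_addr_0.
(* The bound on [a n] has exponent n against n + 1 zeros; r' <= 1 absorbs the extra factor. *)
have lna : n.+1%:R * ln r' <= ln (a n).
  rewrite mulr_natl -lnXn // ler_ln ?posrE ?exprn_gt0 //; apply: le_trans r'n.
  by rewrite exprS ler_piMl // exprn_ge0 // ltW.
have : n.+1%:R^-1 * (ln rho *+ n.+1 - ln (a n)) <= ln rho - ln r'.
  by rewrite mulrC ler_pdivrMr // mulrBl -mulr_natr; lra.
have -> : avg (fun z => ln (Num.max 1 (cabs z / rho))) n.+1 =
  n.+1%:R^-1 * log_excess zeros rho n.+1 by [].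
move=> h; apply: le_trans (lerD Ln (le_trans h ln_ratio)) _; lra.
Unshelve. all: by end_near. Qed.

(** The zeros whose modulus is within d of r contribute at most e / 2; the others are a vanishing
    proportion, each contributing at most B. *)
Lemma zavg_cvg0 (F : R[i] -> R) B : (forall z, cabs z <= 1 -> `|F z| <= B) ->
  (forall e, 0 < e -> exists2 d, 0 < d &
     forall z, cabs z <= 1 -> `|cabs z - r| < d -> `|F z| <= e) ->
  avg F @ \oo --> (0 : R).
Proof.
move=> FB Fr; apply/cvgr0Pnorm_le => e e0.
have e20 : 0 < e / 2 by lra.
have [d d0 Fd] := Fr _ e20.
have B0 : 0 <= B by apply: le_trans (FB 0 _); rewrite ?normr_ge0 // cabs0 ler01.
have out0 := zeros_outside_cvg (r + d) (ltac:(lra)).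
(* For r = 0 no modulus is below r - d, so the factor [0 < r] loses nothing and gives access to
   [zeros_inside_cvg]. *)
have in0 : avg (fun z => (0 < r)%R%:R * (cabs z <= r - d)%R%:R) @ \oo --> (0 : R).
  case: ltP => r0.
    rewrite (_ : (fun z : R[i] => _) = fun z => (cabs z <= r - d)%R%:R).
      by apply: zeros_inside_cvg => //; lra.
    by apply/funext => z; rewrite /= mulr1n mul1r.
  rewrite (_ : avg _ = fun=> 0); first exact: cvg_cst.
  by apply/funext => n; rewrite /zavg big1 ?mulr0 // => z _; rewrite /= mulr0n mul0r.
have bad0 := cvg0Ml B _ (cvg0D _ _ out0 in0).
near=> n.
have bn : B * (avg (fun z => (r + d <= cabs z)%R%:R) n +
   avg (fun z => (0 < r)%R%:R * (cabs z <= r - d)%R%:R) n) <= e / 2.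
  by near: n; exact: cvgr_le _ bad0 _ e20.
have cn : avg (fun=> e / 2) n = e / 2 by near: n; exact: zavg_cst.
apply: le_trans (zavg_norm _ _ _) _.
rewrite [leRHS](_ : e = e / 2 + e / 2); last by lra.
rewrite -{1}cn; apply: le_trans (lerD (lexx _) bn); rewrite -zavgD -zavgZ -zavgD.
apply: ler_zavg => z /le1 z1.
have [h|h] := ltP `|cabs z - r| d.
  apply: le_trans (Fd _ z1 h) _; rewrite lerDl mulr_ge0 // addr_ge0 // mulr_ge0 //.
apply: le_trans (FB _ z1) _.
suff : (1 : R) <= (r + d <= cabs z)%R%:R + (0 < r)%R%:R * (cabs z <= r - d)%R%:R.
  by move=> /(ler_wpM2l B0); lra.
have z0 := cabs_ge0 z; have := rate_ge0.
case: (leP (r + d) (cabs z)) => h1 r0; first by rewrite lerDl mulr_ge0.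
have h2 : cabs z <= r - d.
  by move: h; rewrite ler_normr => /orP[]; lra.
by rewrite h2 (_ : 0 < r) ?mul1r ?add0r //; lra.
Unshelve. all: by end_near. Qed.

End Concentration.

(** * Fejer kernel and Riemann sums *)

Section Heine.
Context {R : realType}.

(** A form of Heine's theorem in which only x must lie in K, so later uses need not locate y. *)
Lemma compact_uniform_continuity (V : pseudoMetricType R) (K : set V) (f : V -> R) :
  compact K -> continuous f -> forall e, 0 < e ->
  exists2 d, 0 < d & forall x y, K x -> ball x d y -> `|f x - f y| <= e.
Proof.
move=> /compact_near_coveringP cK cf e e0.
pose P (d : R) (x : V) := forall y, ball x d y -> `|f x - f y| <= e.
have h : \forall d \near (0 : R)^'+, K `<=` P d.
  apply: (cK _ _ P) => x Kx.
  have e20 : 0 < e / 2 by rewrite divr_gt0.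
  have hx : \forall y \near x, `|f x - f y| < e / 2.
    by move/cvgrPdist_lt: (cf x); apply.
  have [d /= d0 xd] := proj1 (nbhs_ballP _ _) hx.
  have d20 : 0 < d / 2 by rewrite divr_gt0.
  exists (ball x (d / 2), [set i : R | i < d / 2]); first split => /=.
  - exact: nbhsx_ballx.
  - exact: nbhs_right_lt.
  - move=> [x' i] /= [xx' id] y x'y.
    have h1 : `|f x - f x'| < e / 2.
      by apply: xd; apply: le_ball xx'; lra.
    have h2 : `|f x - f y| < e / 2.
      apply: xd; rewrite [d]splitr; apply: ball_triangle xx' _.
      by apply: le_ball x'y; exact: ltW.
    rewrite (_ : f x' - f y = (f x - f y) - (f x - f x')); last by ring.
    apply: le_trans (ler_normB _ _) _.
    by rewrite [leRHS]splitr; apply: lerD; exact: ltW.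
have [d [d0 dK]] := filter_ex (filterI (nbhs_right_gt (0 : R)) h).
by exists d => // x y Kx; exact: dK.
Qed.

End Heine.

Section RiemannSum.
Context {R : realType}.
Local Notation mu := (@lebesgue_measure R).

(** On each piece the mean value theorem writes the increment of a primitive as T / M times a value
    of h, which uniform continuity compares with the value at the left end. *)
Lemma Riemann_sum_cvg (h : R -> R) (T : R) : 0 < T -> continuous h ->
  (fun M : nat => M%:R^-1 * \sum_(j < M) h (j%:R * (T / M%:R))) @ \oo -->
  T^-1 * Rintegral mu `[0, T] h.
Proof.
move=> T0 ch; apply/cvgrPdist_le => e e0.
have hint (u : R) : mu.-integrable `[-1, u] (EFin \o h).
  apply: continuous_compact_integrable; first exact: segment_compact.
  exact: continuous_subspaceT.
(* Starting at -1 puts 0 in the interior, so G is differentiable at both ends of [0, T]. *)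
pose G (x : R) := Rintegral mu `[-1, x] h.
have dG (x : R) : -1 < x -> is_derive x 1 G (h x).
  move=> x1; have xx : x < x + 1 by rewrite ltrDl.
  have [dx <-] := continuous_FTC1_closed xx (hint _) x1 (ch x).
  rewrite derive1E; exact/derivableP.
have cG (x : R) : -1 < x -> {for x, continuous G}.
  by move=> /dG [dx _]; apply/differentiable_continuous/derivable1_diffP.
have intE : Rintegral mu `[0, T] h = G T - G 0.
  rewrite /G Rintegral_itvB ?bnd_simp ?(ltW T0) //.
  rewrite Rintegral_itv_obnd_cbnd //.
  by apply: integrableS (hint T) => //; apply: subset_itv; rewrite bnd_simp; lra.
have [d d0 hd] := compact_uniform_continuity _ _ _ (@segment_compact R 0 T) ch _ e0.
have [M0 M0P] : exists M0 : nat, T / d < M0%:R.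
  by exists (Num.truncn (T / d)).+1; exact: truncnS_gt.
exists M0.+1 => // M /= M0M.
have M_gt0 : (0 : R) < M%:R by rewrite ltr0n (leq_trans _ M0M).
pose t (j : nat) : R := j%:R * (T / M%:R).
have step0 : 0 < T / M%:R by rewrite divr_gt0.
have step j : t j.+1 - t j = T / M%:R by rewrite /t -mulrBl -natrB // subSnn mul1r.
have stepd : T / M%:R < d.
  rewrite ltr_pdivrMr // mulrC -ltr_pdivrMr //; apply: lt_le_trans M0P _.
  by rewrite ler_nat ltnW.
have t_ge0 j : 0 <= t j by rewrite mulr_ge0 // ltW.
have tT j : (j <= M)%N -> t j <= T.
  by move=> jM; rewrite /t mulrCA ler_piMr ?(ltW T0) // ler_pdivrMr // mul1r ler_nat.
have piece j : (j < M)%N -> `|(G (t j.+1) - G (t j)) - T / M%:R * h (t j)| <= T / M%:R * e.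
  move=> jM; have ltt : t j < t j.+1 by rewrite -subr_gt0 step.
  have m1 (x : R) : x \in `[t j, t j.+1] -> -1 < x.
    by rewrite in_itv /= => /andP[+ _]; have := t_ge0 j; lra.
  have [c cj ->] := @MVT _ G h _ _ ltt
    (fun x (xj : x \in `]t j, t j.+1[) => dG x (m1 x (subset_itv_oo_cc xj)))
    (continuous_in_subspaceT (fun x xj => cG x (m1 x (set_mem xj)))).
  rewrite step mulrC -mulrBr normrM gtr0_norm // ler_wpM2l ?(ltW step0) //.
  rewrite distrC; move: cj; rewrite in_itv /= => /andP[c1 c2]; apply: hd.
    by rewrite /= in_itv /= t_ge0 tT // ltnW.
  by rewrite /ball /= distrC gtr0_norm ?subr_gt0 //; have := step j; lra.
have tele : G T - G 0 = \sum_(j < M) (G (t j.+1) - G (t j)).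
  rewrite -(big_mkord xpredT (fun j => G (t j.+1) - G (t j))) telescope_sumr //.
  by rewrite /t mul0r mulrCA mulfV ?mulr1 // gt_eqF.
rewrite intE tele.
have -> : T^-1 * (\sum_(j < M) (G (t j.+1) - G (t j))) - M%:R^-1 * \sum_(j < M) h (t j) =
    T^-1 * \sum_(j < M) ((G (t j.+1) - G (t j)) - T / M%:R * h (t j)).
  rewrite [in RHS](sumrB _ _ _ (fun j : 'I_M => T / M%:R * h (t j))) mulrBr; congr (_ - _); rewrite -mulr_sumr 2!mulrA mulVf ?mul1r //.
  by rewrite gt_eqF.
rewrite normrM gtr0_norm ?invr_gt0 // mulrC ler_pdivrMr //.
apply: le_trans (ler_norm_sum _ _ _) _.
have -> : e * T = \sum_(j < M) T / M%:R * e.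
  by rewrite sumr_const card_ord -mulr_natr; field; rewrite gt_eqF.
by apply: ler_sum => j _; exact: piece.
Qed.

End RiemannSum.

Section Fejer.
Context {R : realType}.
Implicit Types u v : R[i].

(** At u = e^{i s} with u != 1 this is sin^2 (N s / 2) / (N sin^2 (s / 2)); the squared form shows
    positivity. *)
Definition fejer N u : R := N%:R^-1 * cabs (\sum_(k < N) u ^+ k) ^+ 2.

Lemma fejer_ge0 N u : 0 <= fejer N u.
Proof. by rewrite /fejer mulr_ge0 ?invr_ge0 // sqr_ge0. Qed.

(** With truncated subtraction the exponent is |k - m|; the sign of k - m only conjugates the power
    and leaves its real part. *)
Lemma Re_expr_conj u k m : cabs u = 1 ->
  complex.Re (u ^+ k * conjc (u ^+ m)) = complex.Re (u ^+ ((k - m) + (m - k))).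
Proof.
move=> u1; wlog le_mk : k m / (m <= k)%N => [W|].
  case: (leqP m k) => [|/ltnW] le; first exact: W.
  rewrite addnC -(W m k le); case: (u ^+ k) (u ^+ m) => [x y] [x' y'] /=; ring.
rewrite (eqP (le_mk : m - k == 0)%N) addn0 -{1}(subnK le_mk) exprD -mulrA.
by rewrite mulcJ cabsX u1 !expr1n mulr1.
Qed.

Lemma fejerE N u : cabs u = 1 -> fejer N u =
  N%:R^-1 * \sum_(k < N) \sum_(m < N) complex.Re (u ^+ ((k - m) + (m - k))).
Proof.
move=> u1; rewrite /fejer; congr (_ * _).
have -> : cabs (\sum_(k < N) u ^+ k) ^+ 2 =
    complex.Re ((\sum_(k < N) u ^+ k) * conjc (\sum_(k < N) u ^+ k)) by rewrite mulcJ.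
rewrite rmorph_sum mulr_suml cRe_sum; apply: eq_bigr => k _.
rewrite mulr_sumr cRe_sum; apply: eq_bigr => m _.
exact: Re_expr_conj.
Qed.

(** The geometric sum times 1 - u is 1 - u^N, of modulus at most 2. *)
Lemma fejer_le N u : (0 < N)%N -> cabs u = 1 ->
  fejer N u * cabs (1 - u) ^+ 2 <= 4 / N%:R.
Proof.
move=> N0 u1; rewrite /fejer -mulrA -exprMn -cabsM mulrC ler_wpM2r ?invr_ge0 //.
have -> : (\sum_(k < N) u ^+ k) * (1 - u) = 1 - u ^+ N.
  by rewrite mulrC -opprB mulNr -subrX1 opprB.
have : cabs (1 - u ^+ N) <= 2.
  by apply: le_trans (ler_cabsB _ _) _; rewrite cabsX u1 expr1n cabs1.
by have := cabs_ge0 (1 - u ^+ N); nra.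
Qed.

Lemma dist_eq0 (k m : nat) : ((k - m) + (m - k) == 0)%N = (k == m).
Proof. by rewrite addn_eq0 !subn_eq0 -eqn_leq. Qed.

(** Off the diagonal the exponent |k - m| lies strictly between 0 and N <= M, so its sum over the
    roots vanishes; the N diagonal terms give 1. *)
Lemma fejer_unit_root_mean N M u : (0 < N)%N -> (N <= M)%N -> cabs u = 1 ->
  M%:R^-1 * \sum_(j < M) fejer N (u * conjc (unit_root M j)) = 1.
Proof.
move=> N0 NM u1; have M0 : (0 < M)%N by exact: leq_trans NM.
move: (@unit_root R M) (@cabs_unit_root R M) (@sum_unit_rootX R M) => v v1 vs.
have uv j : cabs (u * conjc (v j)) = 1 by rewrite cabsM cabsJ v1 u1 mulr1.
under eq_bigr do rewrite fejerE //.
rewrite -mulr_sumr exchange_big /=.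
under eq_bigr do rewrite exchange_big /=.
have E (k m : 'I_N) : \sum_(j < M) complex.Re
    ((u * conjc (v j)) ^+ ((k - m) + (m - k))) = M%:R *+ (k == m).
  have [<-|km] := eqVneq k m.
    rewrite subnn; under eq_bigr do rewrite expr0.
    by rewrite sumr_const card_ord.
  have dlt : (0 < (k - m) + (m - k) < M)%N.
    rewrite lt0n dist_eq0 val_eqE km /=.
    apply: leq_trans NM; case: (leqP k m) => [km'|/ltnW mk].
      by rewrite (eqP (km' : k - m == 0)%N) add0n (leq_ltn_trans (leq_subr _ _)).
    by rewrite (eqP (mk : m - k == 0)%N) addn0 (leq_ltn_trans (leq_subr _ _)).
  rewrite -cRe_sum; under eq_bigr do rewrite exprMn -rmorphXn.
  by rewrite -mulr_sumr -rmorph_sum vs // rmorph0 mulr0.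
under eq_bigr do under eq_bigr do rewrite E.
have -> : \sum_(k < N) \sum_(m < N) (M%:R : R) *+ (k == m) = N%:R * M%:R.
  under eq_bigr => k _.
    rewrite (bigD1 k) //= eqxx big1 ?addr0; last first.
      by move=> m mk; rewrite eq_sym (negPf mk).
    over.
  by rewrite sumr_const card_ord mulr_natl.
by rewrite mulKf ?mulVf // pnatr_eq0 -lt0n.
Qed.

(** The kernel has mean 1. Roots within d of u cost at most e; at the others g varies by at most 2 B
    and the kernel is at most 4 / (N d^2), whence the 8. *)
Lemma fejer_approx (g : R[i] -> R) (B e d : R) N M u :
  (0 < N)%N -> (N <= M)%N -> cabs u = 1 -> 0 < d -> 0 <= e ->
  (forall v, cabs v = 1 -> `|g v| <= B) ->
  (forall v, cabs v = 1 -> cabs (u - v) < d -> `|g v - g u| <= e) ->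
  `|M%:R^-1 * \sum_(j < M) g (unit_root M j) * fejer N (u * conjc (unit_root M j)) - g u|
   <= e + 8 * B / (N%:R * d ^+ 2).
Proof.
move=> N0 NM u1 d0 e0 gB gu.
have M0 : (0 < M)%N by exact: leq_trans NM.
have N0' : (0 : R) < N%:R by rewrite ltr0n.
have M0' : (0 : R) < M%:R by rewrite ltr0n.
have B0 : 0 <= B by apply: le_trans (gB u u1).
have mean := fejer_unit_root_mean _ _ _ N0 NM u1.
pose w j := fejer N (u * conjc (unit_root M j)).
have -> : M%:R^-1 * \sum_(j < M) g (unit_root M j) * w j - g u =
    M%:R^-1 * \sum_(j < M) (g (unit_root M j) - g u) * w j.
  under [in RHS]eq_bigr do rewrite mulrBl.
  by rewrite sumrB -mulr_sumr mulrBr [M%:R^-1 * (g u * _)]mulrCA mean mulr1.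
have term j : `|(g (unit_root M j) - g u) * w j| <= e * w j + 8 * B / (N%:R * d ^+ 2).
  have w0 : 0 <= w j := fejer_ge0 _ _.
  rewrite normrM (ger0_norm w0); have := @cabs_unit_root R M j; rewrite /w in w0 *.
  move: (unit_root M j) w0 => v w0 v1; set wj := fejer _ _ in w0 *.
  have R0 : 0 <= 8 * B / (N%:R * d ^+ 2).
    by rewrite divr_ge0 ?mulr_ge0 ?sqr_ge0 // ltW.
  have [uv|uv] := ltP (cabs (u - v)) d.
    by apply: le_trans (ler_wpM2r w0 (gu v v1 uv)) _; rewrite lerDl.
  have g2 : `|g v - g u| <= 2 * B.
    apply: le_trans (ler_normB _ _) _.
    by rewrite mulr_natl mulr2n; apply: lerD; exact: gB.
  apply: (@le_trans _ _ (2 * B * wj)); first exact: ler_wpM2r.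
  apply: (@le_trans _ _ (8 * B / (N%:R * d ^+ 2))); last by rewrite lerDr mulr_ge0.
  have uv1 : cabs (u * conjc v) = 1 by rewrite cabsM cabsJ u1 v1 mulr1.
  have := fejer_le _ _ N0 uv1; rewrite -/wj.
  have -> : cabs (1 - u * conjc v) = cabs (u - v).
    by rewrite mulrC cabs_reflect.
  move=> wle; rewrite ler_pdivlMr ?mulr_gt0 ?exprn_gt0 //.
  have : wj * d ^+ 2 <= 4 / N%:R.
    apply: le_trans wle; apply: ler_wpM2l => //.
    by rewrite lerXn2r ?nnegrE ?cabs_ge0 // ltW.
  rewrite ler_pdivlMr // => /(ler_wpM2l B0); lra.
rewrite normrM gtr0_norm ?invr_gt0 //.
apply: (@le_trans _ _ (M%:R^-1 * \sum_(j < M) (e * w j + 8 * B / (N%:R * d ^+ 2)))).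
  rewrite ler_wpM2l ?invr_ge0 //; apply: le_trans (ler_norm_sum _ _ _) _.
  by apply: ler_sum => j _; exact: term.
rewrite big_split /= -mulr_sumr mulrDr mulrCA mean mulr1 sumr_const card_ord.
by rewrite -[X in _ * X]mulr_natl mulKf // gt_eqF.
Qed.

End Fejer.

(** * Equidistribution of the arguments of the zeros *)

Lemma cvg0_sum {R : realType} N (u : nat -> nat -> R) :
  (forall i, (i < N)%N -> u i @ \oo --> (0 : R)) ->
  (fun n => \sum_(i < N) u i n) @ \oo --> (0 : R).
Proof.
elim: N => [|N IHN] u0.
  by under eq_fun do rewrite big_ord0; exact: cvg_cst.
under eq_fun do rewrite big_ord_recr /=.
by apply: cvg0D; [apply: IHN => i iN; exact/u0/ltnW|exact: u0].
Qed.

Section Direction.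
Context {R : realType}.
Implicit Types z : R[i].

(* dir 0 = 1, so that every dir z lies on the unit circle. *)
Definition dir z : R[i] := if z == 0 then 1 else z / (cabs z)%:C%C.

Lemma cabs_dir z : cabs (dir z) = 1.
Proof.
rewrite /dir; case: eqVneq => [_|z0]; first exact: cabs1.
by rewrite cabsM -fmorphV cabs_real ger0_norm ?invr_ge0 ?cabs_ge0 // mulfV ?cabs_eq0.
Qed.

Lemma dirE z : z = (cabs z)%:C%C * dir z.
Proof.
rewrite /dir; case: eqVneq => [->|z0]; first by rewrite cabs0 mul0r.
by rewrite mulrC divfK // fmorph_eq0 cabs_eq0.
Qed.

End Direction.

Section Equidistribution.
Context {R : realType} (mu : probability R R) (Phi : nat -> {poly R[i]}).
Variables (zeros : nat -> seq R[i]) (r : R).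
Hypotheses (muC : circle_prob mu) (muI : nontrivial mu).
Hypothesis PhiP : is_monic_OPUC mu Phi.
Hypothesis zerosP : forall n, Phi n = \prod_(z <- zeros n) ('X - z%:P).
Local Notation a n := (cabs (verblunsky Phi n)).
Local Notation avg := (zavg zeros).
Hypothesis root_a : (fun n : nat => a n `^ (n%:R^-1)) @ \oo --> r.
Hypothesis mean_a : (fun n : nat => n%:R^-1 * \sum_(j < n) a j) @ \oo --> (0 : R).
Hypothesis r_gt0 : 0 < r.

(** With u = z / |z|, write r^m u^m = z^m + (r^m - |z|^m) u^m: the first term is a power sum, and
    the second is small because the moduli concentrate at r. *)
Lemma dir_moment_cvg m : (0 < m)%N ->
  (fun n => n%:R^-1 * cabs (\sum_(z <- zeros n) dir z ^+ m)) @ \oo --> (0 : R).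
Proof.
case: m => // m _; have [c c0 hc] := power_sum_bound _ _ _ muC muI PhiP zerosP m.
pose F (z : R[i]) := `|r ^+ m.+1 - cabs z ^+ m.+1|.
have F0 : avg F @ \oo --> (0 : R).
  apply: (zavg_cvg0 _ _ _ _ muC muI PhiP zerosP root_a _ (r ^+ m.+1 + 1)).
    move=> z z1; rewrite /F ger0_norm //; apply: le_trans (ler_normB _ _) _.
    rewrite !ger0_norm ?exprn_ge0 ?cabs_ge0 ?(ltW r_gt0) // lerD2l.
    by rewrite exprn_ile1 // cabs_ge0.
  move=> e e0; have hx : \forall y \near r, `|r ^+ m.+1 - y ^+ m.+1| < e.
    by move/cvgrPdist_lt: (@exprn_continuous R m.+1 r); apply.
  have [d /= d0 xd] := proj1 (nbhs_ballP _ _) hx; exists d => // z _ zd.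
  by rewrite /F normr_id; apply/ltW/xd; rewrite /ball /= distrC.
have bound := cvg0Ml (r ^- m.+1) _ (cvg0D _ _ (cvg0Ml c _ mean_a) F0).
apply: (squeeze_cvgr _ (cvg_cst 0) bound); near=> n.
rewrite mulr_ge0 ?invr_ge0 ?cabs_ge0 //= [leRHS]mulrC ler_pdivlMr ?exprn_gt0 //.
have -> : n%:R^-1 * cabs (\sum_(z <- zeros n) dir z ^+ m.+1) * r ^+ m.+1 =
    n%:R^-1 * cabs (\sum_(z <- zeros n) (r ^+ m.+1)%:C%C * dir z ^+ m.+1).
  by rewrite -mulr_sumr cabsM cabs_real gtr0_norm ?exprn_gt0 //; ring.
have -> : \sum_(z <- zeros n) (r ^+ m.+1)%:C%C * dir z ^+ m.+1 =
    \sum_(z <- zeros n) z ^+ m.+1 +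
    \sum_(z <- zeros n) (r ^+ m.+1 - cabs z ^+ m.+1)%:C%C * dir z ^+ m.+1.
  rewrite -big_split /=; apply: eq_bigr => z _.
  by rewrite {2}(dirE z) exprMn rmorphB /= !rmorphXn /= mulrBl addrC subrK.
rewrite mulrCA -mulrDr ler_wpM2l ?invr_ge0 //; apply: le_trans (ler_cabsD _ _) _.
apply: lerD; first exact: hc.
apply: le_trans (ler_cabs_sum _ _ _ _) _; apply: ler_sum => z _.
by rewrite cabsM cabsX cabs_dir expr1n mulr1 cabs_real.
Unshelve. all: by end_near. Qed.

Lemma fejer_off_diag N (u : R[i]) : (0 < N)%N -> cabs u = 1 -> fejer N u - 1 =
  N%:R^-1 * \sum_(k < N) \sum_(m < N)
     (if (k == m :> nat) then 0 else complex.Re (u ^+ ((k - m) + (m - k)))).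
Proof.
move=> N0 u1; have N0' : N%:R != 0 :> R by rewrite pnatr_eq0 -lt0n.
rewrite [X in _ - X](_ : 1 = N%:R^-1 * \sum_(k < N) \sum_(m < N) ((k == m :> nat)%:R : R)); last first.
  under eq_bigr => k _.
    rewrite (bigD1 k) //= eqxx big1 ?addr0; last first.
      by move=> m mk; rewrite val_eqE eq_sym (negPf mk).
    over.
  by rewrite sumr_const card_ord mulVf.
rewrite fejerE // -mulrBr -sumrB; congr (_ * _); apply: eq_bigr => k _.
rewrite -sumrB; apply: eq_bigr => m _; case: eqP => [->|_]; last by rewrite subr0.
by rewrite subnn expr0 /= subrr.
Qed.

(** Without its diagonal the kernel is a finite combination of moments of the directions of order |k
    - m| > 0; multiplying by powers of conj v keeps the modulus. *)
Lemma fejer_zavg_cvg N (v : R[i]) : (0 < N)%N -> cabs v = 1 ->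
  avg (fun z => fejer N (dir z * conjc v) - 1) @ \oo --> (0 : R).
Proof.
move=> N0 v1.
pose E (k m : nat) (z : R[i]) : R := if k == m then 0
  else complex.Re ((dir z * conjc v) ^+ ((k - m) + (m - k))).
have uv z : cabs (dir z * conjc v) = 1 by rewrite cabsM cabsJ cabs_dir v1 mulr1.
have -> : avg (fun z => fejer N (dir z * conjc v) - 1) =
    fun n => N%:R^-1 * \sum_(k < N) \sum_(m < N) avg (E k m) n.
  apply/funext => n; under eq_bigr do rewrite -zavg_sum.
  rewrite -zavg_sum -zavgZ; congr (zavg _ _ _); apply/funext => z.
  exact: fejer_off_diag.
apply/cvg0Ml/(@cvg0_sum R N (fun k n => \sum_(m < N) avg (E k m) n)) => k _.
apply/(@cvg0_sum R N (fun m => avg (E k m))) => m _; rewrite /E.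
have [km|km] := eqVneq k m.
  rewrite (_ : avg _ = fun=> 0); first exact: cvg_cst.
  by apply/funext => n; rewrite /zavg big1 ?mulr0.
have d0 : (0 < (k - m) + (m - k))%N by rewrite lt0n dist_eq0.
apply: norm_cvg0; apply: (squeeze_cvgr _ (cvg_cst 0) (dir_moment_cvg _ d0)).
near=> n; rewrite normr_ge0 /zavg normrM ger0_norm ?invr_ge0 //.
rewrite ler_wpM2l ?invr_ge0 // -cRe_sum; apply: le_trans (ler_Re_cabs _) _.
under eq_bigr do rewrite exprMn.
by rewrite -mulr_suml cabsM cabsX cabsJ v1 expr1n mulr1.
Unshelve. all: by end_near. Qed.

(** The Fejer mean [W] at M-th roots of unity is uniformly close to g on directions. Its average
    over the zeros tends to the mean [S] of g over those roots, a Riemann sum of the integral. *)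
Lemma zavg_dir_cvg (f : R * R -> R) (B : R) : continuous f -> (forall p, `|f p| <= B) ->
  avg (fun z => f (r * complex.Re (dir z), r * complex.Im (dir z))) @ \oo -->
  (2 * pi)^-1 * Rintegral lebesgue_measure `[0, 2 * pi]%classic
                    (fun t : R => f (r * cos t, r * sin t)).
Proof.
move=> cf fB; set I0 := (X in _ --> X).
pose g (u : R[i]) := f (r * complex.Re u, r * complex.Im u).
pose h (t : R) := f (r * cos t, r * sin t).
have pi2 : (0 : R) < 2 * pi by rewrite mulr_gt0 // pi_gt0.
have ch : continuous h.
  move=> t; apply: (@continuous_comp _ _ _ (fun t : R => (r * cos t, r * sin t)) f); last exact: cf.
  have c1 : r * cos x @[x --> t] --> r * cos t by apply: cvgMl_tmp; exact: continuous_cos.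
  have c2 : r * sin x @[x --> t] --> r * sin t by apply: cvgMl_tmp; exact: continuous_sin.
  exact: cvg_pair c1 c2.
have rsum : (fun M : nat => M%:R^-1 * \sum_(j < M) g (unit_root M j)) @ \oo --> I0.
  exact: Riemann_sum_cvg pi2 ch.
have B0 : 0 <= B by apply: le_trans (fB (0, 0)).
apply/cvgrPdist_le => e e0.
have e40 : 0 < e / 4 by rewrite divr_gt0.
pose K : set (R * R) := `[- r, r]%classic `*` `[- r, r]%classic.
have cK : compact K by apply: compact_setX; exact: segment_compact.
have [d d0 fd] := compact_uniform_continuity _ _ _ cK cf _ e40.
have d'0 : 0 < d / r by rewrite divr_gt0.
have gd u v : cabs u = 1 -> cabs v = 1 -> cabs (u - v) < d / r -> `|g v - g u| <= e / 4.
  move=> u1 v1 uv; rewrite distrC; apply: fd.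
    have bnd x : `|x| <= 1 -> `[- r, r]%classic (r * x).
      move=> x1; rewrite /= in_itv /= -ler_norml normrM gtr0_norm //.
      by rewrite ler_piMr // ltW.
    by split; apply: bnd; rewrite -u1; [exact: ler_Re_cabs|exact: ler_Im_cabs].
  have lip x : `|x| <= cabs (u - v) -> `|r * x| < d.
    move=> xle; rewrite normrM gtr0_norm // mulrC -ltr_pdivlMr //.
    exact: le_lt_trans uv.
  split; rewrite /ball /= -mulrBr; apply: lip.
    by apply: le_trans (ler_Re_cabs _); rewrite cReD; case: (v).
  by apply: le_trans (ler_Im_cabs _); rewrite cImD; case: (v).
(* N is fixed first, to make the tail of [fejer_approx] at distance d / r at most e / 4; M >= N is
   then chosen for the Riemann sum, and n grows last. *)
have [N [N0 NB]] : exists N : nat, (0 < N)%N /\ 8 * B / ((d / r) ^+ 2 * (e / 4)) < N%:R.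
  by eexists (Num.truncn _).+1; split => //; exact: truncnS_gt.
have NP : 8 * B / (N%:R * (d / r) ^+ 2) <= e / 4.
  have d2 : 0 < (d / r) ^+ 2 by rewrite exprn_gt0.
  rewrite ler_pdivrMr; last by rewrite mulr_gt0 ?ltr0n.
  move/ltW: NB; rewrite ler_pdivrMr; last exact: mulr_gt0.
  by rewrite [e / 4 * _]mulrC -!mulrA.
have [M [NM MP]] : exists M, (N <= M)%N /\
    `|I0 - M%:R^-1 * \sum_(j < M) g (unit_root M j)| <= e / 4.
  have near1 : \forall M \near \oo, (N <= M)%N by exists N.
  have near2 : \forall M \near \oo, `|I0 - M%:R^-1 * \sum_(j < M) g (unit_root M j)| <= e / 4.
    by move/cvgrPdist_le: rsum; apply.
  by have [M [h1 h2]] := filter_ex (filterI near1 near2); exists M.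
pose S := M%:R^-1 * \sum_(j < M) g (unit_root M j).
pose W z := M%:R^-1 * \sum_(j < M) g (unit_root M j) * fejer N (dir z * conjc (unit_root M j)).
have W0 : avg (fun z => W z - S) @ \oo --> (0 : R).
  have -> : avg (fun z => W z - S) = fun n => M%:R^-1 * \sum_(j < M) g (unit_root M j) *
      avg (fun z => fejer N (dir z * conjc (unit_root M j)) - 1) n.
    apply/funext => n; under eq_bigr do rewrite -zavgZ.
    rewrite -zavg_sum -zavgZ; congr (zavg _ _ _); apply/funext => z.
    rewrite /W /S -mulrBr -sumrB; congr (_ * _); apply: eq_bigr => j _.
    by rewrite mulrBr mulr1.
  apply/cvg0Ml/(@cvg0_sum R M (fun j n => g (unit_root M j) * 
      avg (fun z => fejer N (dir z * conjc (unit_root M j)) - 1) n)) => j _.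
  by apply/cvg0Ml/fejer_zavg_cvg => //; exact: cabs_unit_root.
near=> n.
have cn : avg (fun=> e / 4 + e / 4) n = e / 4 + e / 4.
  by near: n; exact: (zavg_cst _ _ _ PhiP zerosP).
have Sn : avg (fun=> S) n = S by near: n; exact: (zavg_cst _ _ _ PhiP zerosP).
have Wn : `|avg (fun z => W z - S) n| <= e / 4.
  by near: n; move/cvgr0Pnorm_le: W0; apply.
have gW : `|avg (fun z => g (dir z) - W z) n| <= e / 4 + e / 4.
  apply: le_trans (zavg_norm _ _ _) _; rewrite -{1}cn; apply: ler_zavg => z _.
  rewrite distrC; apply: le_trans (lerD (lexx _) NP).
  apply: fejer_approx => //; [exact: cabs_dir|exact: ltW|by move=> v _; exact: fB|].
  by move=> v v1; apply: gd => //; exact: cabs_dir.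
have -> : avg (fun z => f (r * complex.Re (dir z), r * complex.Im (dir z))) n =
    avg (fun z => g (dir z) - W z) n + (avg (fun z => W z - S) n + avg (fun=> S) n).
  by rewrite -!zavgD; congr (zavg _ _ _); apply/funext => z; rewrite /g; ring.
rewrite Sn; move: MP; rewrite -/S => MP.
rewrite (_ : I0 - _ = (I0 - S) - avg (fun z => g (dir z) - W z) n - avg (fun z => W z - S) n);
  last by ring.
apply: le_trans (ler_normB _ _) _; apply: le_trans (lerD (ler_normB _ _) Wn) _.
by apply: le_trans (lerD (lerD MP gW) (lexx _)) _; lra.
Unshelve. all: by end_near. Qed.

End Equidistribution.

(** * Weak convergence of the zero counting measures *)

Theorem theorem6p2 (R : realType) (mu : probability R R) (Phi : nat -> {poly R[i]})
  (r : R) (zeros : nat -> seq R[i]) :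
  circle_prob mu -> nontrivial mu -> is_monic_OPUC mu Phi ->
  (fun n : nat => cabs (verblunsky Phi n) `^ (n%:R^-1)) @ \oo --> r ->
  (fun n : nat => n%:R^-1 * \sum_(j < n) cabs (verblunsky Phi j)) @ \oo --> (0 : R) ->
  (* zeros n lists the zeros of Phi n, repeated according to multiplicity *)
  (forall n, Phi n = \prod_(z <- zeros n) ('X - z%:P)) ->
  (* weak convergence nu_n -> uniform measure on {|z| = r}, tested against
     bounded continuous f : C = R x R -> R *)
  forall f : R * R -> R, continuous f -> (exists M : R, forall p, `|f p| <= M) ->
    (fun n : nat => n%:R^-1 * \sum_(z <- zeros n) f (complex.Re z, complex.Im z)) @ \oo -->
    (2 * pi)^-1 * Rintegral lebesgue_measure `[0, 2 * pi]%classic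
                    (fun t : R => f (r * cos t, r * sin t)).
Proof.
move=> muC muI PhiP root_a mean_a zerosP f cf [B fB].
have r_ge0 : 0 <= r := rate_ge0 _ _ root_a.
set I0 := (X in _ --> X).
pose F (z : R[i]) := f (complex.Re z, complex.Im z).
pose G (z : R[i]) := f (r * complex.Re (dir z), r * complex.Im (dir z)).
have GI : zavg zeros G @ \oo --> I0.
  (* For r = 0 the limit is the point mass at the origin and G is constant, so directions are
     irrelevant. *)
  have [r0|rN0] := eqVneq r 0; last first.
    by apply: (zavg_dir_cvg _ _ _ _ muC muI PhiP zerosP root_a mean_a) cf fB; rewrite lt_def rN0.
  have -> : I0 = f (0, 0).
    rewrite /I0 r0; under eq_Rintegral do rewrite !mul0r.
    have pi2 : (0 : R) < 2 * pi by rewrite mulr_gt0 // pi_gt0.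
    have mE : lebesgue_measure `[0, 2 * pi]%classic = (2 * pi)%:E :> \bar R.
      by rewrite lebesgue_measure_itv /= lte_fin pi2 sube0.
    rewrite Rintegral_cst //.
    transitivity ((2 * pi)^-1 * (f (0, 0) * fine (2 * pi)%:E)).
      by congr (_ * (_ * fine _)); exact: mE.
    by rewrite /= mulrCA mulVf ?mulr1 // gt_eqF.
  have -> : G = fun=> f (0, 0) by apply/funext => z; rewrite /G r0 !mul0r.
  apply: cvg_near_cst; exact: (zavg_cst _ _ _ PhiP zerosP).
(* Moving z radially to modulus r shifts each coordinate by at most the distance from |z| to r, so
   uniform continuity on a square containing the disc makes F - G small near |z| = r. *)
have FG : zavg zeros (fun z => F z - G z) @ \oo --> (0 : R).
  apply: (zavg_cvg0 _ _ _ _ muC muI PhiP zerosP root_a _ (B + B)).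
    by move=> z _; apply: le_trans (ler_normB _ _) _; apply: lerD; exact: fB.
  move=> e e0.
  pose K : set (R * R) := `[- 1, 1]%classic `*` `[- 1, 1]%classic.
  have cK : compact K by apply: compact_setX; exact: segment_compact.
  have [d d0 fd] := compact_uniform_continuity _ _ _ cK cf _ e0.
  exists d => // z z1 zd; apply: fd.
    by split; rewrite /= in_itv /= -ler_norml; apply: le_trans z1;
      [exact: ler_Re_cabs|exact: ler_Im_cabs].
  have d1 := cabs_dir z.
  have lip x : `|x| <= cabs (dir z) -> `|cabs z * x - r * x| < d.
    by rewrite d1 => x1; apply: le_lt_trans zd; rewrite -mulrBl normrM ler_piMr.
  split; rewrite /ball /= {1}(dirE z).
    by have := lip _ (ler_Re_cabs (dir z)); case: (dir z) => x y /=; rewrite mul0r subr0.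
  by have := lip _ (ler_Im_cabs (dir z)); case: (dir z) => x y /=; rewrite mul0r addr0.
have h := cvgD FG GI; rewrite add0r in h.
suff -> : (fun n : nat => n%:R^-1 * \sum_(z <- zeros n) F z) =
    (fun n => zavg zeros (fun z => F z - G z) n + zavg zeros G n) by exact: h.
apply/funext => n; rewrite -zavgD /zavg; congr (_ * _).
by apply: eq_bigr => z _; rewrite subrK.
Qed.
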